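(* Let $k$ be an algebraically closed field, let $\mathcal{A}$ be a spectroid over $k$, and let $M$ be an indecomposable object of $\operatorname{mod}\mathcal{A}$. (1) If $M$ is not projective, then there is an almost split sequence ending in $M$ in $\operatorname{mod}\mathcal{A}$ if and only if $M$ is finitely presented. (2) If $M$ is not injective, then there is an almost split sequence starting in $M$ in $\operatorname{mod}\mathcal{A}$ if and only if $M$ is finitely co-presented.
   Context: $k$ is an algebraically closed field; all categories are preadditive $k$-categories. A spectroid is a Hom-finite $k$-category $\mathcal{A}$ (all Hom spaces are finite dimensional over $k$) in which all objects have local endomorphism algebras and distinct objects are not isomorphic. $\operatorname{Mod}\mathcal{A}$ is the category of all $k$-linear covariant functors from $\mathcal{A}$ to $k$-vector spaces, and $\operatorname{mod}\mathcal{A}$ is its full subcategory of functors with values in finite dimensional $k$-vector spaces (locally finite dimensional modules). Projective and injective are understood in $\operatorname{mod}\mathcal{A}$. For an object $a$ of $\mathcal{A}$, put $P_a=\operatorname{Hom}_{\mathcal{A}}(a,-)$ and $I_a=D\operatorname{Hom}_{\mathcal{A}}(-,a)$, with $D=\operatorname{Hom}_k(-,k)$ applied pointwise. A module $M$ is finitely generated if there is an epimorphism $\bigoplus_{i=1}^r P_{a_i}\to M$ for finitely many objects $a_1,\dots,a_r$, and finitely presented if moreover the kernel of this epimorphism is finitely generated. Dually, $M$ is finitely co-generated if there is a monomorphism $M\to\bigoplus_{i=1}^s I_{b_i}$ for finitely many objects $b_1,\dots,b_s$, and finitely co-presented if moreover the cokernel of this monomorphism is finitely co-generated. An almost split sequence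 in $\operatorname{mod}\mathcal{A}$, starting in $L$ and ending in $N$, is a non-split short exact sequence $0\to L\xrightarrow{f} E\xrightarrow{g} N\to 0$ with $L,N$ indecomposable such that every morphism $L\to X$ in $\operatorname{mod}\mathcal{A}$ that is not a section factors through $f$ and every morphism $X\to N$ in $\operatorname{mod}\mathcal{A}$ that is not a retraction factors through $g$. *)

(* Defs.v *)
From HB Require Import structures.
From mathcomp Require Import all_boot all_order all_algebra.

Set Implicit Arguments.
Unset Strict Implicit.
Unset Printing Implicit Defensive.

Import GRing.Theory.
Local Open Scope ring_scope.

(* Hom-finite k-categories; finite dimensionality of the Hom spaces is carried
   by [vectType], and [comp g f] is the composite "f first, then g". *)
Record homFinCat (k : fieldType) := HomFinCat {
  obj :> Type;
  hom : obj -> obj -> vectType k;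
  idm : forall a, hom a a;
  comp : forall a b c, hom b c -> hom a b -> hom a c;
  comp_linear_l : forall a b c (f : hom a b), linear (fun g : hom b c => comp g f);
  comp_linear_r : forall a b c (g : hom b c), linear (fun f : hom a b => comp g f);
  compA : forall a b c d (h : hom c d) (g : hom b c) (f : hom a b),
    comp h (comp g f) = comp (comp h g) f;
  comp1m : forall a b (f : hom a b), comp (idm b) f = f;
  compm1 : forall a b (f : hom a b), comp f (idm a) = f }.

Arguments hom {k} C a b : rename.
Arguments idm {k} C a : rename.
Arguments comp {k C a b c} g f : rename.

Section Spectroids.
Variables (k : fieldType) (C : homFinCat k).

Definition is_iso (a b : C) (f : hom C a b) : Prop :=
  exists g : hom C b a, comp g f = idm C a /\ comp f g = idm C b.

(* End(a) is local: its non-units form a two-sided ideal.  Membership of 0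
   in this ideal says that End(a) is not the zero ring. *)
Definition local_end (a : C) : Prop :=
  [/\ ~ is_iso (0 : hom C a a),
      forall f g : hom C a a, ~ is_iso f -> ~ is_iso g -> ~ is_iso (f + g),
      forall f g : hom C a a, ~ is_iso f -> ~ is_iso (comp g f)
    & forall f g : hom C a a, ~ is_iso f -> ~ is_iso (comp f g)].

End Spectroids.

Record spectroid (k : fieldType) := Spectroid {
  spectroid_cat :> homFinCat k;
  spectroid_local : forall a : spectroid_cat, local_end a;
  spectroid_skeletal : forall a b : spectroid_cat,
    (exists f : hom spectroid_cat a b, is_iso f) -> a = b }.

(* The objects of mod A. *)
Record lfdMod (k : fieldType) (A : homFinCat k) := LfdMod {
  modAt :> A -> vectType k;
  modMap : forall a b, {linear hom A a b -> 'Hom(modAt a, modAt b)};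
  modMap1 : forall a, modMap a a (idm A a) = \1%VF;
  modMapM : forall a b c (g : hom A b c) (f : hom A a b),
    modMap a c (comp g f) = (modMap b c g \o modMap a b f)%VF }.

Arguments modMap {k A} M {a b} : rename.

(* The morphisms of mod A.  They are compared componentwise, by [eqmod]. *)
Record modHom (k : fieldType) (A : homFinCat k) (M N : lfdMod A) := ModHom {
  component :> forall a, 'Hom(M a, N a);
  naturality : forall a b (f : hom A a b),
    (component b \o modMap M f)%VF = (modMap N f \o component a)%VF }.

Section ModuleCategory.
Variables (k : fieldType) (A : homFinCat k).
Implicit Types L M N E X Y Z : lfdMod A.

Definition eqmod M N (u v : modHom M N) : Prop := forall a, u a = v a.

Fact idmod_natural M a b (f : hom A a b) :
  (\1 \o modMap M f)%VF = (modMap M f \o \1)%VF.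
Proof. by rewrite comp_lfun1l comp_lfun1r. Qed.

Definition idmod M : modHom M M := ModHom (@idmod_natural M).

Fact compmod_natural L M N (v : modHom M N) (u : modHom L M) a b
    (f : hom A a b) :
  ((v b \o u b) \o modMap L f)%VF = (modMap N f \o (v a \o u a))%VF.
Proof. by rewrite -comp_lfunA naturality !comp_lfunA naturality. Qed.

Definition compmod L M N (v : modHom M N) (u : modHom L M) : modHom L N :=
  ModHom (compmod_natural v u).

Definition epimorphism M N (p : modHom M N) : Prop :=
  forall Z (u v : modHom N Z),
    eqmod (compmod u p) (compmod v p) -> eqmod u v.

Definition monomorphism M N (i : modHom M N) : Prop :=
  forall Z (u v : modHom Z M),
    eqmod (compmod i u) (compmod i v) -> eqmod u v.

Definition is_section M N (f : modHom M N) : Prop :=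
  exists r : modHom N M, eqmod (compmod r f) (idmod M).

Definition is_retraction M N (g : modHom M N) : Prop :=
  exists s : modHom N M, eqmod (compmod g s) (idmod N).

Definition isomorphic M N : Prop :=
  exists (u : modHom M N) (v : modHom N M),
    eqmod (compmod v u) (idmod M) /\ eqmod (compmod u v) (idmod N).

Definition projective_mod M : Prop :=
  forall X Y (p : modHom X Y) (u : modHom M Y), epimorphism p ->
    exists v : modHom M X, eqmod (compmod p v) u.

Definition injective_mod M : Prop :=
  forall X Y (i : modHom X Y) (u : modHom X M), monomorphism i ->
    exists v : modHom Y M, eqmod (compmod v i) u.

Definition short_exact L E N (f : modHom L E) (g : modHom E N) : Prop :=
  forall a, [/\ lker (f a) = 0%VS, limg (f a) = lker (g a)
              & limg (g a) = fullv].

Definition zero_mod_at (a : A) : vectType k := 'rV[k]_0.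

Fact zero_modMap1 (a : A) :
  (\0 : {linear hom A a a -> 'Hom(zero_mod_at a, zero_mod_at a)}) (idm A a)
    = \1%VF.
Proof. by apply/lfunP => x; apply/rowP => -[]. Qed.

Fact zero_modMapM (a b c : A) (g : hom A b c) (f : hom A a b) :
  (\0 : {linear hom A a c -> 'Hom(zero_mod_at a, zero_mod_at c)}) (comp g f)
  = ((\0 : {linear hom A b c -> 'Hom(zero_mod_at b, zero_mod_at c)}) g
      \o (\0 : {linear hom A a b -> 'Hom(zero_mod_at a, zero_mod_at b)}) f)%VF.
Proof. by apply/lfunP => x; apply/rowP => -[]. Qed.

Definition zero_mod : lfdMod A := LfdMod zero_modMap1 zero_modMapM.

Section DirectSum.
Variables M N : lfdMod A.

Definition dsum_at a : vectType k := (M a * N a)%type.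

Section Map.
Variables a b : A.

Definition dsum_fun (f : hom A a b) (x : dsum_at a) : dsum_at b :=
  (modMap M f x.1, modMap N f x.2).

Fact dsum_fun_linear f : linear (dsum_fun f).
Proof. by move=> t x y; rewrite /dsum_fun /= !linearP. Qed.
HB.instance Definition _ f :=
  GRing.isLinear.Build k (dsum_at a) (dsum_at b) _ (dsum_fun f)
    (dsum_fun_linear f).

Definition dsum_map (f : hom A a b) : 'Hom(dsum_at a, dsum_at b) :=
  linfun (dsum_fun f).

Fact dsum_map_linear : linear dsum_map.
Proof.
move=> t f g; apply/lfunP => x.
by rewrite add_lfunE scale_lfunE !lfunE /= /dsum_fun !linearP
  !add_lfunE !scale_lfunE.
Qed.
HB.instance Definition _ :=
  GRing.isLinear.Build k (hom A a b) 'Hom(dsum_at a, dsum_at b) _ dsum_map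
    dsum_map_linear.

End Map.

Fact dsum_map1 a : dsum_map (idm A a) = \1%VF.
Proof.
by apply/lfunP => -[x y]; rewrite !lfunE /= /dsum_fun !modMap1 !id_lfunE.
Qed.

Fact dsum_mapM a b c (g : hom A b c) (f : hom A a b) :
  dsum_map (comp g f) = (dsum_map g \o dsum_map f)%VF.
Proof.
by apply/lfunP => x; rewrite comp_lfunE !lfunE /= /dsum_fun !modMapM
  !comp_lfunE.
Qed.

Definition dsum : lfdMod A :=
  @LfdMod k A dsum_at (fun a b => @dsum_map a b) dsum_map1 dsum_mapM.

End DirectSum.

Definition big_dsum (s : seq (lfdMod A)) : lfdMod A := foldr dsum zero_mod s.

Definition is_zero_mod M : Prop := forall a (x : M a), x = 0.

Definition indecomposable M : Prop :=
  ~ is_zero_mod M /\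
  forall X Y, isomorphic M (dsum X Y) -> is_zero_mod X \/ is_zero_mod Y.

Section Representable.
Variable a : A.

Section Maps.
Variables b c : A.

Definition postcomp (f : hom A b c) (x : hom A a b) : hom A a c := comp f x.
Definition precomp (f : hom A b c) (x : hom A c a) : hom A b a := comp x f.

HB.instance Definition _ (f : hom A b c) :=
  GRing.isLinear.Build k (hom A a b) (hom A a c) _ (postcomp f)
    (comp_linear_r f).
HB.instance Definition _ (f : hom A b c) :=
  GRing.isLinear.Build k (hom A c a) (hom A b a) _ (precomp f)
    (comp_linear_l f).

Definition proj_map (f : hom A b c) : 'Hom(hom A a b, hom A a c) :=
  linfun (postcomp f).

Fact proj_map_linear : linear proj_map.
Proof.
move=> t f g; apply/lfunP => x.
by rewrite add_lfunE scale_lfunE !lfunE /= /postcomp comp_linear_l.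
Qed.
HB.instance Definition _ :=
  GRing.isLinear.Build k (hom A b c) 'Hom(hom A a b, hom A a c) _ proj_map
    proj_map_linear.

Definition inj_fun (f : hom A b c) (phi : 'Hom(hom A b a, k^o)) :
    'Hom(hom A c a, k^o) :=
  (phi \o linfun (precomp f))%VF.

Fact inj_fun_linear f : linear (inj_fun f).
Proof. by move=> t x y; rewrite /inj_fun comp_lfunDl comp_lfunZl. Qed.
HB.instance Definition _ f :=
  GRing.isLinear.Build k 'Hom(hom A b a, k^o) 'Hom(hom A c a, k^o) _
    (inj_fun f) (inj_fun_linear f).

Definition inj_map (f : hom A b c) :
    'Hom('Hom(hom A b a, k^o), 'Hom(hom A c a, k^o)) :=
  linfun (inj_fun f).

Fact inj_map_linear : linear inj_map.
Proof.
move=> t f g; apply/lfunP => phi; apply/lfunP => x.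
rewrite add_lfunE scale_lfunE !lfunE /= /inj_fun.
by do !rewrite lfunE /=; rewrite /precomp comp_linear_r linearP.
Qed.
HB.instance Definition _ :=
  GRing.isLinear.Build k (hom A b c)
    'Hom('Hom(hom A b a, k^o), 'Hom(hom A c a, k^o)) _ inj_map inj_map_linear.

End Maps.

Fact proj_map1 b : proj_map (idm A b) = \1%VF.
Proof. by apply/lfunP => x; rewrite !lfunE /= /postcomp comp1m. Qed.

Fact proj_mapM b c d (g : hom A c d) (f : hom A b c) :
  proj_map (comp g f) = (proj_map g \o proj_map f)%VF.
Proof. by apply/lfunP => x; rewrite comp_lfunE !lfunE /= /postcomp compA. Qed.

Fact inj_map1 b : inj_map (idm A b) = \1%VF.
Proof.
apply/lfunP => phi; apply/lfunP => x.
by do !rewrite lfunE /=; rewrite /precomp compm1.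
Qed.

Fact inj_mapM b c d (g : hom A c d) (f : hom A b c) :
  inj_map (comp g f) = (inj_map g \o inj_map f)%VF.
Proof.
apply/lfunP => phi; apply/lfunP => x.
by do !rewrite lfunE /=; rewrite /precomp compA.
Qed.

(* P_a = Hom(a, -) and I_a = D Hom(-, a). *)
Definition proj_mod : lfdMod A :=
  @LfdMod k A (hom A a) (fun b c => @proj_map b c) proj_map1 proj_mapM.

Definition inj_mod : lfdMod A :=
  @LfdMod k A (fun b => 'Hom(hom A b a, k^o)) (fun b c => @inj_map b c)
    inj_map1 inj_mapM.

End Representable.

Definition proj_sum (s : seq A) : lfdMod A := big_dsum [seq proj_mod a | a <- s].
Definition inj_sum (s : seq A) : lfdMod A := big_dsum [seq inj_mod a | a <- s].

Definition fin_generated M : Prop :=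
  exists (s : seq A) (p : modHom (proj_sum s) M), epimorphism p.

Definition fin_cogenerated M : Prop :=
  exists (s : seq A) (i : modHom M (inj_sum s)), monomorphism i.

Definition fin_presented M : Prop :=
  exists (s : seq A) (p : modHom (proj_sum s) M)
         (K : lfdMod A) (i : modHom K (proj_sum s)),
    short_exact i p /\ fin_generated K.

Definition fin_copresented M : Prop :=
  exists (s : seq A) (i : modHom M (inj_sum s))
         (Q : lfdMod A) (p : modHom (inj_sum s) Q),
    short_exact i p /\ fin_cogenerated Q.

Definition almost_split L E N (f : modHom L E) (g : modHom E N) : Prop :=
  [/\ short_exact f g /\ ~ is_retraction g,
      indecomposable L,
      indecomposable N,
      forall X (u : modHom L X), ~ is_section u ->
        exists v : modHom E X, eqmod (compmod v f) u
    & forall X (u : modHom X N), ~ is_retraction u ->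
        exists v : modHom X E, eqmod (compmod g v) u].

Definition almost_split_ending M : Prop :=
  exists (L E : lfdMod A) (f : modHom L E) (g : modHom E M), almost_split f g.

Definition almost_split_starting M : Prop :=
  exists (E N : lfdMod A) (f : modHom M E) (g : modHom E N), almost_split f g.

End ModuleCategory.

(* Main.v *)
From Stdlib Require List.
From HB Require Import structures.
From mathcomp Require Import all_boot all_order all_algebra.
From mathcomp Require Import boolp.
From mathcomp Require classical_sets.
Require Import Defs.

Set Implicit Arguments.
Unset Strict Implicit.
Unset Printing Implicit Defensive.

Import GRing.Theory.
Local Open Scope ring_scope.

(** The second equivalence is the first one over the opposite category:
    finite dimensional spaces have perfect duals, so modules over a category
    and over its opposite come in dual pairs, and duality exchanges the sums of
    the [proj_mod a] with the sums of the [inj_mod a]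
    ([dual_almost_split_starting], [dual_fin_presented]). It remains to treat
    the sequences that end in [M].

    Suppose that all the non-retractions into [M] lift along [g : E -> M] and
    that [g] is not a retraction. If [M] were not finitely generated, then the
    inclusions of its finitely generated submodules would all lift. A section
    of [g] is a solution of a system of linear equations with unknowns in the
    finite dimensional spaces [Hom(M a, E a)], each equation involving finitely
    many unknowns; the lifts solve all the finite subsystems, so the system has
    a solution ([affine_compactness]) and [g] is a retraction, a contradiction.
    Now let [P -> M] be an epimorphism with kernel [K], where [P] is a finite
    sum of representables. If for no finitely generated submodule [K'] of [K]
    the map [P / K' -> M] were a retraction, then all these maps would lift,
    and as [Hom(P, E)] is finite dimensional, a single morphism [P -> E] would
    kill every [K'] ([directed_affine_point]), again giving a section of [g].
    So some [P / K' -> M] is a retraction; its kernel [K / K'] is a quotient of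
    [P / K'], hence [K] is finitely generated
    ([lifts_nonretractions_fin_presented]).

    Conversely, let [P1 -> P0 -> M -> 0] be a presentation by finite sums of
    representables, and let [nu] be the Nakayama functor, for which
    [D Hom(P, X) = Hom(X, nu P)]. By Fitting's lemma the non-invertible
    endomorphisms of [M] form an ideal. So there is a functional on
    [Hom(P0, M)] that vanishes at the composites of [P0 -> M] with them and is
    [1] at [P0 -> M] itself. It corresponds to a morphism [M -> nu P0], and
    the pullback of [nu P1 -> nu P0] along it is a morphism [g : E -> M], with
    the same kernel [L] as [nu P1 -> nu P0]. By naturality [u : X -> M] lifts
    along [g] exactly when the functional vanishes at the composites of
    [P0 -> M] with [u v] for all [v : M -> X]. So the non-retractions lift and
    the identity does not; and [g] is an epimorphism, because no map
    [proj_mod a -> M] is a retraction when [M] is not projective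
    ([fin_presented_extension]).

    This presentation is arbitrary, so [L] may decompose. But [L] is a
    submodule of [nu P1], so a morphism into [L] vanishes as soon as it does at
    a fixed finite family of objects; the dimension of [L] at that family
    decreases when the sequence is pushed out onto a proper summand of [L], and
    an indecomposable kernel is reached ([indecomposable_kernel]). Fitting's
    lemma then applies to the kernel and shows that it starts an almost split
    sequence ([lifts_nonretractions_extends]). *)

(** * Linear algebra *)

Section LinearAlgebra.
Variable k : fieldType.
Implicit Types V W Z : vectType k.

Definition lin_of (V W : lmodType k) (f : V -> W) (fl : linear f) : {linear V
  -> W} :=
  HB.pack f (GRing.isLinear.Build k V W _ f fl).

Definition lfun_of V W (f : V -> W) (fl : linear f) : 'Hom(V, W) :=
  linfun (lin_of fl).

Lemma lfun_ofE V W (f : V -> W) (fl : linear f) x : lfun_of fl x = f x.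
Proof. by rewrite lfunE. Qed.

Lemma linear_affine (V W : lmodType k) (f : {linear V -> W}) x y z t :
  f (z + t *: (x - y)) = f z + t *: (f x - f y).
Proof. by rewrite linearD linearZ_LR linearB. Qed.

Lemma ker0_inj V W (f : 'Hom(V, W)) :
  (forall x, f x = 0 -> x = 0) -> lker f = 0%VS.
Proof.
move=> f0; apply/eqP; rewrite -subv0; apply/subvP=> x.
by rewrite memv_ker memv0 => /eqP/f0->.
Qed.

Lemma img_fullP V W (f : 'Hom(V, W)) :
  (forall y, exists x, f x = y) <-> limg f = fullv.
Proof.
split=> [fs|fE y].
  apply/eqP; rewrite eqEsubv subvf; apply/subvP=> y _.
  by have [x <-] := fs y; rewrite memv_img ?memvf.
have : y \in limg f by rewrite fE memvf.
by case/memv_imgP=> x _ ->; exists x.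
Qed.

(** A subspace of maximal dimension among those on which [S] holds. *)
Lemma subspace_of_pred V (S : V -> Prop) :
    S 0 -> (forall t x y, S x -> S y -> S (t *: x + y)) ->
  exists U : {vspace V}, forall x, x \in U <-> S x.
Proof.
move=> S0 SL.
pose P n := `[< exists U : {vspace V},
                  (forall x, x \in U -> S x) /\ \dim U = n >].
have exP : exists n, P n.
  exists 0%N; apply/asboolP; exists 0%VS; split; last by rewrite dimv0.
  by move=> x; rewrite memv0 => /eqP->.
have bP n : P n -> (n <= \dim {:V})%N.
  by case/asboolP=> U [_ <-]; rewrite dimvS ?subvf.
case: (ex_maxnP exP bP) => n /asboolP[U [US dU]] nmax.
exists U => x; split; first exact: US.
move=> Sx; have : P (\dim (<[x]> + U)%VS).
  apply/asboolP; exists (<[x]> + U)%VS; split=> // y.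
  by case/memv_addP=> z /vlineP[t ->] [u /US Su ->]; apply: SL.
move/nmax => dle; have : (U == <[x]> + U)%VS.
  by rewrite eqEdim addvSr dU dle.
by move/eqP->; apply: (subvP (addvSl _ _)); apply: memv_line.
Qed.

Lemma nonzero_functional V (x : V) :
  x != 0 -> exists phi : 'Hom(V, k^o), phi x = 1.
Proof.
move=> x0; case: (pselect (exists i, coord (vbasis fullv) i x != 0)) => [[i
  ci]|no].
  pose c := linfun (coord (vbasis fullv) i : {linear V -> k^o}).
  exists ((c x)^-1 *: c); rewrite scale_lfunE /c lfunE /=.
  exact: mulVf.
move/eqP: x0; case; rewrite (coord_vbasis (memvf x)) big1 // => i _.
by have [->|ci] := eqVneq (coord (vbasis fullv) i x) 0; rewrite ?scale0r //;
  case: no; exists i.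
Qed.

(** A complement of [U] serves as the quotient space. *)
Definition quot_proj V (U : {vspace V}) : 'Hom(V, subvs_of U^C) :=
  (linfun (@vsproj _ _ U^C) \o (\1 - projv U))%VF.

Lemma quot_proj_eq0 V (U : {vspace V}) x : quot_proj U x = 0 <-> x \in U.
Proof.
rewrite comp_lfunE lfunE /= add_lfunE opp_lfunE id_lfunE; split=> [q0|xU].
  have: vsval (vsproj U^C (x - projv U x)) = 0 by rewrite q0.
  by rewrite vsprojK ?memv_projC // => /subr0_eq->; rewrite memv_proj.
by rewrite projv_id // subrr linear0.
Qed.

Lemma quot_proj_surj V (U : {vspace V}) y : exists x, quot_proj U x = y.
Proof.
exists (vsval y); rewrite comp_lfunE lfunE /= add_lfunE opp_lfunE id_lfunE.
suff -> : projv U (vsval y) = 0 by rewrite subr0 vsvalK.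
by apply/eqP; rewrite -memv_ker lker_proj subvsP.
Qed.

Lemma separating_functional V (U : {vspace V}) x : x \notin U ->
  exists phi : 'Hom(V, k^o), (forall y, y \in U -> phi y = 0) /\ phi x = 1.
Proof.
move=> xU; have [|phi phi1] := @nonzero_functional _ (quot_proj U x).
  by apply: contra xU => /eqP/quot_proj_eq0.
exists (phi \o quot_proj U)%VF; split=> [y /quot_proj_eq0 q0|].
  by rewrite comp_lfunE q0 linear0.
by rewrite comp_lfunE.
Qed.

Lemma functionals_separate V (x : V) :
  (forall phi : 'Hom(V, k^o), phi x = 0) -> x = 0.
Proof.
move=> x0; apply/eqP; apply: contraT => /nonzero_functional[phi].
by rewrite x0 => /esym/eqP; rewrite oner_eq0.
Qed.

Lemma lfun_factor V W Z (f : 'Hom(V, W)) (g : 'Hom(V, Z)) :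
    (forall x, f x = 0 -> g x = 0) ->
  exists h : 'Hom(W, Z), forall x, h (f x) = g x.
Proof.
move=> fg; exists (g \o f^-1)%VF => x.
rewrite comp_lfunE; apply: subr0_eq; rewrite -linearB; apply: fg.
by rewrite linearB /= limg_lfunVK ?subrr // memv_img ?memvf.
Qed.

(** A member whose direction space has minimal dimension is contained in all
    the others, because the family is directed. *)
Lemma directed_affine_point V (J : Type) (j0 : J) (Q : J -> V -> Prop) :
    (forall j, exists x, Q j x) ->
    (forall j t x y z, Q j x -> Q j y -> Q j z -> Q j (z + t *: (x - y))) ->
    (forall i j, exists l, forall x, Q l x -> Q i x /\ Q j x) ->
  exists x, forall j, Q j x.
Proof.
move=> Qne Qaff Qdir.
(* The direction space of [Q j]. *)
pose D j v := forall z, Q j z -> Q j (z + v).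
have Ddiff j x y : Q j x -> Q j y -> D j (x - y).
  by move=> Qx Qy z Qz; have := Qaff j 1 x y z Qx Qy Qz; rewrite scale1r.
have exU j : exists U : {vspace V}, forall v, v \in U <-> D j v.
  apply: subspace_of_pred => [z|t x y Dx Dy z Qz]; first by rewrite addr0.
  rewrite addrA; apply: Dy; have := Qaff j t (z + x) z z (Dx _ Qz) Qz Qz.
  by rewrite [z + x]addrC addrK.
pose P n := `[< exists j, exists2 U : {vspace V},
                  (forall v, v \in U <-> D j v) & \dim U = n >].
have exP : exists n, P n.
  have [U UE] := exU j0.
  by exists (\dim U); apply/asboolP; exists j0; exists U.
case: (ex_minnP exP) => n /asboolP[i [U UE dU]] nmin.
have [x Qx] := Qne i; exists x => j.
have [l lQ] := Qdir i j; have [y Qy] := Qne l.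
have [W WE] := exU l.
have WU : (W <= U)%VS.
  apply/subvP=> v /WE Dv; apply/UE.
  have := Ddiff i (y + v) y (lQ _ (Dv _ Qy)).1 (lQ _ Qy).1.
  by rewrite [y + v]addrC addrK.
have /nmin dle : P (\dim W) by apply/asboolP; exists l; exists W.
have WUE : W = U by apply/eqP; rewrite eqEdim WU dU dle.
have : D l (x - y) by apply/WE; rewrite WUE; apply/UE/Ddiff => //;
  case: (lQ _ Qy).
by move/(_ y Qy)/lQ => [_]; rewrite addrC subrK.
Qed.

Definition iter_lfun V (f : 'Hom(V, V)) n : 'Hom(V, V) :=
  iter n (fun g => (f \o g)%VF) \1%VF.

Lemma iter_lfunE V (f : 'Hom(V, V)) n x : iter_lfun f n x = iter n f x.
Proof.
elim: n => [|n IH]; first by rewrite id_lfunE.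
by rewrite /iter_lfun iterS comp_lfunE -/(iter_lfun f n) IH.
Qed.

Lemma iter_lfunD V (f : 'Hom(V, V)) m n :
  iter_lfun f (m + n) = (iter_lfun f m \o iter_lfun f n)%VF.
Proof. by apply/lfunP=> x; rewrite comp_lfunE !iter_lfunE iterD. Qed.

Lemma iter_img_stabilizes V (f : 'Hom(V, V)) : exists2 n, (0 < n)%N &
  limg (iter_lfun f (n + n)) = limg (iter_lfun f n) /\
  lker (iter_lfun f (n + n)) = lker (iter_lfun f n).
Proof.
pose P d := `[< exists2 n, (0 < n)%N & \dim (limg (iter_lfun f n)) = d >].
have exP : exists d, P d.
  by exists (\dim (limg (iter_lfun f 1))); apply/asboolP; exists 1%N.
case: (ex_minnP exP) => d /asboolP[n n0 dn] dmin.
exists n => //.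
have sub : (limg (iter_lfun f (n + n)) <= limg (iter_lfun f n))%VS.
  rewrite iter_lfunD limg_comp; apply: limgS; exact: subvf.
have imE : limg (iter_lfun f (n + n)) = limg (iter_lfun f n).
  apply/eqP; rewrite eqEdim sub dn; apply: dmin.
  by apply/asboolP; exists (n + n)%N; rewrite ?addn_gt0 ?n0.
split=> //; apply/esym/eqP; rewrite eqEdim; apply/andP; split.
  apply/subvP=> x; rewrite !memv_ker iter_lfunD comp_lfunE => /eqP->.
  by rewrite linear0.
have := limg_ker_dim (iter_lfun f (n + n)) fullv.
rewrite -(limg_ker_dim (iter_lfun f n) fullv) imE !capfv.
by move/eqP; rewrite eqn_add2r => /eqP->.
Qed.

(** Both sides say that [f] and its square have the same rank, hence the same
    image and the same kernel. *)
Lemma square_image_kernel V (f : 'Hom(V, V)) :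
  (forall x, exists y, f x = f (f y)) <-> (forall x, f (f x) = 0 -> f x = 0).
Proof.
have kerS : (lker f <= lker (f \o f))%VS.
  by apply/subvP => x; rewrite !memv_ker comp_lfunE => /eqP->; rewrite linear0.
have imS : (limg (f \o f) <= limg f)%VS.
  by rewrite limg_comp; apply: limgS; apply: subvf.
have := limg_ker_dim (f \o f)%VF fullv.
rewrite -(limg_ker_dim f fullv) !capfv => dimE; split=> [fs x ffx|fi x].
  suff E : lker f = lker (f \o f) by apply/eqP;
    rewrite -memv_ker E memv_ker comp_lfunE ffx.
  have E : limg (f \o f) = limg f.
    apply/eqP; rewrite eqEsubv imS; apply/subvP => _ /memv_imgP[y _ ->].
    by have [z ->] := fs y; rewrite -comp_lfunE memv_img ?memvf.
  apply/eqP; rewrite eqEdim kerS; move/eqP: dimE.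
  by rewrite E eqn_add2r => /eqP ->; rewrite leqnn.
have E : lker (f \o f) = lker f.
  apply/eqP; rewrite eqEsubv kerS andbT; apply/subvP => y.
  by rewrite !memv_ker comp_lfunE => /eqP/fi->.
have {}E : limg (f \o f) = limg f.
  apply/eqP; rewrite eqEdim imS; move/eqP: dimE.
  by rewrite E eqn_add2l => /eqP ->; rewrite leqnn.
have : f x \in limg (f \o f) by rewrite E memv_img ?memvf.
by case/memv_imgP => y _; rewrite comp_lfunE; exists y.
Qed.

Lemma inj_endo_surj V (f : 'Hom(V, V)) :
  (forall x, f x = 0 -> x = 0) -> forall y, exists x, f x = y.
Proof.
move=> fi; apply/img_fullP; apply/eqP; rewrite eqEdim subvf.
by rewrite limg_dim_eq ?leqnn // capfv; apply: ker0_inj.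
Qed.

End LinearAlgebra.
(** * Compactness of linear systems *)

Section Compactness.
Variables (k : fieldType) (I : Type) (V : I -> vectType k).
Variable C : seq I -> (forall i, V i) -> Prop.
Hypothesis C_ne : forall l, exists e, C l e.
Hypothesis C_ext : forall l e e',
  (forall i, List.In i l -> e i = e' i) -> C l e -> C l e'.
Hypothesis C_aff : forall l t x y z, C l x -> C l y -> C l z ->
  C l (fun i => z i + t *: (x i - y i)).
Hypothesis C_cat : forall l l' e, C (l ++ l') e -> C l e /\ C l' e.

Let partial := forall i, option (V i).
Let extends (p : partial) (e : forall i, V i) := forall i v, p i = Some v -> e
  i = v.
Let good (p : partial) := forall l, exists e, C l e /\ extends p e.
Let le_partial (s t : {p | good p}) : bool :=
  `[< forall i v, sval s i = Some v -> sval t i = Some v >].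

Let chain_bound (S : {p | good p} -> Prop) :
  (forall s t, S s -> S t -> le_partial s t \/ le_partial t s) ->
  exists t, forall s, S s -> le_partial s t.
Proof.
move=> Stot; case: (pselect (exists s, S s)) => [[s0 Ss0]|noS]; last first.
  have good0 : good (fun=> None) by move=> l; have [e Ce] := C_ne l; exists e.
  by exists (exist _ _ good0) => s Ss; case: noS; exists s.
pose p i : option (V i) :=
  match pselect (exists v, exists2 s, S s & sval s i = Some v) with
  | left h => Some (projT1 (cid h))
  | right _ => None
  end.
have pE s i v : S s -> sval s i = Some v -> p i = Some v.
  move=> Ss si; rewrite /p; case: pselect => [h|[]]; last by exists v; exists s.
  case: (cid h) => w [s' Ss' s'i] /=; congr Some.
  have [/asboolP le|/asboolP le] := Stot _ _ Ss Ss'.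
    by have := le _ _ si; rewrite s'i => -[].
  by have := le _ _ s'i; rewrite si => -[].
have pex i v : p i = Some v -> exists2 s, S s & sval s i = Some v.
  rewrite /p; case: pselect => [h|//].
  by case: (cid h) => w [s Ss si] /= [<-]; exists s.
have pfin l : exists2 s, S s &
    forall i v, List.In i l -> p i = Some v -> sval s i = Some v.
  elim: l => [|j l [s Ss sl]]; first by exists s0.
  case pj: (p j) => [w|]; last first.
    exists s => // i v [ji|il] pi; last exact: sl.
    by subst j; rewrite pj in pi.
  have [s' Ss' s'j] := pex _ _ pj.
  have [/asboolP le|/asboolP le] := Stot _ _ Ss Ss'.
    exists s' => // i v [ji|il] pi; last by apply/le/sl.
    by subst j; rewrite -pi pj.
  exists s => // i v [ji|il] pi; last exact: sl.
  by subst j; apply: le; rewrite -pi pj.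
have goodp : good p.
  move=> l; have [s Ss sl] := pfin l; have [e [Ce es]] := svalP s l.
  exists (fun i => if p i is Some v then v else e i); split.
    apply: C_ext Ce => i il; case pi: (p i) => [v|//].
    exact/es/sl.
  by move=> i v ->.
exists (exist _ p goodp) => s Ss; apply/asboolP => i v; exact: pE.
Qed.

(** A partial choice of coordinates that extends to a solution over every
    finite set of indices can be enlarged at one more index, the admissible
    values there forming a directed family of affine subspaces of a finite
    dimensional space; a maximal one is total. *)
Lemma affine_compactness : exists e, forall l, C l e.
Proof.
have [||||[t tgood] tmax] := @classical_sets.Zorn _ le_partial.
- by move=> s; apply/asboolP.
- move=> r s t /asboolP rs /asboolP st; apply/asboolP => i v ri.
  exact/st/rs.
- move=> [s gs] [t gt] /asboolP /= st /asboolP /= ts.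
  have E : s = t.
    apply: functional_extensionality_dep => i.
    case si: (s i) => [v|]; first by rewrite (st _ _ si).
    by case ti: (t i) => [v|//]; rewrite -(ts _ _ ti).
  by subst t; congr exist; apply: Prop_irrelevance.
- exact: chain_bound.
have ttot i : exists v, t i = Some v.
  case ti: (t i) => [v|]; first by exists v.
  pose Q l v := exists e, [/\ C l e, extends t e & e i = v].
  have [|||v Qv] := @directed_affine_point _ (V i) _ nil Q.
  - by move=> l; have [e [Ce te]] := tgood l; exists (e i), e.
  - move=> l s x y z [ex [Cx tx <-]] [ey [Cy ty <-]] [ez [Cz tz <-]].
    exists (fun j => ez j + s *: (ex j - ey j)); split=> //; first exact: C_aff.
    by move=> j v tj; rewrite (tx _ _ tj) (ty _ _ tj) (tz _ _ tj) subrr scaler0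
      addr0.
  - move=> l l'; exists (l ++ l') => x [e [/C_cat[Cl Cl'] te ei]].
    by split; exists e.
  pose t' : partial := fun j =>
    match pselect (i = j) with
    | left E => Some (eq_rect i V v j E)
    | right _ => t j
    end.
  have t'good : good t'.
    move=> l; have [e [Ce te ei]] := Qv l; exists e; split=> // j w.
    rewrite /t'; case: pselect => [E [<-]|_]; last exact: te.
    by subst j; rewrite /= ei.
  have tE : exist _ t' t'good = exist _ t tgood.
    apply: tmax; apply/asboolP => j w /= tj; rewrite /t'.
    by case: pselect => [Eij|//]; subst j; rewrite ti in tj.
  by have := congr1 (fun s => sval s i) tE; rewrite /= ti /t'; case: pselect.
exists (fun i => projT1 (cid (ttot i))) => l.
have [e [Ce te]] := tgood l; apply: C_ext Ce => i _.
by case: (cid (ttot i)) => v tv /=; apply: te.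
Qed.

End Compactness.

(** * Modules and their morphisms *)

Section Modules.
Variables (k : fieldType) (A : homFinCat k).
Implicit Types L M N E X Y Z : lfdMod A.

Lemma naturalE M N (u : modHom M N) a b (f : hom A a b) x :
  u b (modMap M f x) = modMap N f (u a x).
Proof. by have /lfunP/(_ x) := naturality u f; rewrite !comp_lfunE. Qed.

Lemma modMap_id M a x : modMap M (idm A a) x = x.
Proof. by rewrite modMap1 id_lfunE. Qed.

Lemma modMap_comp M a b c (g : hom A b c) (f : hom A a b) x :
  modMap M (comp g f) x = modMap M g (modMap M f x).
Proof. by rewrite modMapM comp_lfunE. Qed.

Lemma modMap_lin M a b (x : M a) : linear (fun f : hom A a b => modMap M f x).
Proof. by move=> t f g; rewrite linearP add_lfunE scale_lfunE. Qed.

Lemma eqmodE M N (u v : modHom M N) : eqmod u v -> forall a x, u a x = v a x.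
Proof. by move=> uv a x; rewrite uv. Qed.

Lemma eqmodI M N (u v : modHom M N) : (forall a x, u a x = v a x) -> eqmod u v.
Proof. by move=> uv a; apply/lfunP => x; apply: uv. Qed.

Section MkHom.
Variables (M N : lfdMod A) (u : forall a, M a -> N a).
Hypothesis ul : forall a, linear (@u a).
Hypothesis un : forall a b (f : hom A a b) x, u (modMap M f x) = modMap N f (u
  x).

Fact mkhom_natural a b (f : hom A a b) :
  (lfun_of (@ul b) \o modMap M f = modMap N f \o lfun_of (@ul a))%VF.
Proof. by apply/lfunP => x; rewrite !comp_lfunE !lfun_ofE un. Qed.

Definition mkhom : modHom M N := ModHom mkhom_natural.

Lemma mkhomE a x : mkhom a x = u x.
Proof. exact: lfun_ofE. Qed.
End MkHom.

Section MkMod.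
Variables (V : A -> vectType k) (m : forall a b, hom A a b -> V a -> V b).
Hypothesis ml : forall a b (f : hom A a b), linear (m f).
Hypothesis mr : forall a b (x : V a), linear (fun f : hom A a b => m f x).
Hypothesis m1 : forall a (x : V a), m (idm A a) x = x.
Hypothesis mM : forall a b c (g : hom A b c) (f : hom A a b) x,
  m (comp g f) x = m g (m f x).

Fact mkmod_linear a b : linear (fun f : hom A a b => lfun_of (ml f)).
Proof.
by move=> t f g; apply/lfunP=> x; rewrite add_lfunE scale_lfunE !lfun_ofE mr.
Qed.

Fact mkmod1 a : lin_of (@mkmod_linear a a) (idm A a) = \1%VF.
Proof. by apply/lfunP=> x; rewrite lfun_ofE m1 id_lfunE. Qed.

Fact mkmodM a b c (g : hom A b c) (f : hom A a b) :
  lin_of (@mkmod_linear a c) (comp g f) =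
  (lin_of (@mkmod_linear b c) g \o lin_of (@mkmod_linear a b) f)%VF.
Proof. by apply/lfunP=> x; rewrite comp_lfunE !lfun_ofE mM. Qed.

Definition mkmod : lfdMod A :=
  @LfdMod k A V (fun a b => lin_of (@mkmod_linear a b)) mkmod1 mkmodM.

Lemma mkmodE a b (f : hom A a b) (x : V a) : modMap mkmod f x = m f x.
Proof. exact: lfun_ofE. Qed.
End MkMod.

End Modules.
(** * Exact sequences *)

Section Exactness.
Variables (k : fieldType) (A : homFinCat k).
Implicit Types L M N E X Y Z K : lfdMod A.

Definition pointwise_inj M N (u : modHom M N) : Prop :=
  forall a x, u a x = 0 -> x = 0.
Definition pointwise_surj M N (u : modHom M N) : Prop :=
  forall a y, exists x, u a x = y.
Definition exact_pair L M N (u : modHom L M) (v : modHom M N) : Prop :=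
  forall a y, v a y = 0 <-> exists x, u a x = y.

Definition ses L E N (f : modHom L E) (g : modHom E N) : Prop :=
  [/\ pointwise_inj f, exact_pair f g & pointwise_surj g].

Lemma pointwise_injP M N (u : modHom M N) a x y :
  pointwise_inj u -> u a x = u a y -> x = y.
Proof.
move=> ui uxy; apply: subr0_eq; apply: (ui a).
by rewrite linearB /= uxy subrr.
Qed.

Lemma short_exactP L E N (f : modHom L E) (g : modHom E N) :
  short_exact f g <-> ses f g.
Proof.
split=> [fg|[fi fgE gs] a].
  split=> a; have [f0 fgE gs] := fg a.
  - by move=> x /eqP; rewrite -memv_ker f0 memv0 => /eqP.
  - move=> y; split=> [/eqP|[x <-]].
      by rewrite -memv_ker -fgE => /memv_imgP[x _ ->]; exists x.
    by apply/eqP; rewrite -memv_ker -fgE memv_img ?memvf.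
  - exact/img_fullP.
split; first by apply: ker0_inj => x; apply: fi.
  apply/vspaceP => y; rewrite memv_ker; apply/memv_imgP/eqP => [[x _ ->]|].
    by apply/fgE; exists x.
  by move/fgE=> [x <-]; exists x; rewrite ?memvf.
exact/img_fullP/gs.
Qed.

Definition zerohom M N : modHom M N :=
  @mkhom _ _ M N (fun _ _ => 0)
    (fun a t x y => esym (eq_trans (addr0 _) (scaler0 _ t)))
    (fun a b f x => esym (linear0 (modMap N f))).

Fact lchom_linear M N t (u v : modHom M N) a :
  linear (fun x => t *: u a x + v a x).
Proof.
move=> s x y; rewrite [u a _]linearP [v a _]linearP !scalerDr !scalerA [t *
  s]mulrC.
by rewrite -!addrA; congr (_ + _); rewrite addrCA.
Qed.

Fact lchom_natural M N t (u v : modHom M N) a b (f : hom A a b) x :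
  t *: u b (modMap M f x) + v b (modMap M f x)
  = modMap N f (t *: u a x + v a x).
Proof. by rewrite !naturalE linearP. Qed.

Definition lchom M N t (u v : modHom M N) : modHom M N :=
  mkhom (lchom_linear t u v) (lchom_natural t u v).

Lemma zerohomE M N a x : zerohom M N a x = 0. Proof. exact: mkhomE. Qed.
Lemma lchomE M N t (u v : modHom M N) a x :
  lchom t u v a x = t *: u a x + v a x.
Proof. exact: mkhomE. Qed.
Lemma idmodE M a x : idmod M a x = x. Proof. exact: id_lfunE. Qed.
Lemma compmodE L M N (v : modHom M N) (u : modHom L M) a x :
  compmod v u a x = v a (u a x).
Proof. exact: comp_lfunE. Qed.

Lemma factor_surj M Q Z (q : modHom M Q) (w : modHom M Z) :
    pointwise_surj q -> (forall a x, q a x = 0 -> w a x = 0) ->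
  exists h : modHom Q Z, forall a x, h a (q a x) = w a x.
Proof.
move=> qs qw.
have hE a x : (w a \o (q a)^-1)%VF (q a x) = w a x.
  rewrite comp_lfunE; apply: subr0_eq; rewrite -linearB; apply: qw.
  by rewrite linearB /= limg_lfunVK ?subrr // memv_img ?memvf.
have hn a b (f : hom A a b) :
    ((w b \o (q b)^-1) \o modMap Q f = modMap Z f \o (w a \o (q a)^-1))%VF.
  apply/lfunP => y; have [x <-] := qs a y.
  by rewrite comp_lfunE -naturalE hE naturalE [RHS]comp_lfunE hE.
by exists (ModHom hn).
Qed.

Lemma factor_inj K N Z (i : modHom K N) (w : modHom Z N) :
    pointwise_inj i -> (forall a z, exists x, i a x = w a z) ->
  exists h : modHom Z K, forall a z, i a (h a z) = w a z.
Proof.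
move=> ii iw.
have hE a z : i a (((i a)^-1 \o w a)%VF z) = w a z.
  rewrite comp_lfunE limg_lfunVK //.
  by have [x <-] := iw a z; rewrite memv_img ?memvf.
have hn a b (f : hom A a b) :
    (((i b)^-1 \o w b) \o modMap Z f = modMap K f \o ((i a)^-1 \o w a))%VF.
  apply/lfunP => z; apply: (pointwise_injP ii).
  by rewrite comp_lfunE hE comp_lfunE !naturalE hE.
by exists (ModHom hn).
Qed.

Lemma bijective_isom M N (u : modHom M N) :
    pointwise_inj u -> pointwise_surj u ->
  exists v : modHom N M, (forall a x, v a (u a x) = x)
    /\ (forall a y, u a (v a y) = y).
Proof.
move=> ui us; have [|v vE] := @factor_inj M N N u (idmod N) ui.
  by move=> a z; have [x <-] := us a z; exists x; rewrite idmodE.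
have uv a y : u a (v a y) = y by rewrite vE idmodE.
by exists v; split=> // a x; apply: (pointwise_injP ui).
Qed.

Lemma submodule_exists M (U : forall a, {vspace M a}) :
    (forall a b (f : hom A a b) x, x \in U a -> modMap M f x \in U b) ->
  exists K (i : modHom K M), pointwise_inj i
    /\ forall a y, y \in U a <-> exists x, i a x = y.
Proof.
move=> Us.
pose m a b (f : hom A a b) (x : subvs_of (U a)) : subvs_of (U b) :=
  vsproj (U b) (modMap M f (vsval x)).
have mE a b (f : hom A a b) x : vsval (m a b f x) = modMap M f (vsval x).
  by rewrite vsprojK // Us // subvsP.
have [ml mr m1 mM] : [/\ forall a b (f : hom A a b), linear (m a b f),
    forall a b x, linear (fun f : hom A a b => m a b f x),
    forall a x, m a a (idm A a) x = x
  & forall a b c (g : hom A b c) (f : hom A a b) x,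
      m a c (comp g f) x = m b c g (m a b f x)].
  split.
  - by move=> a b f t x y; apply: subvs_inj;
      rewrite [RHS]linearP /= !mE -linearP.
  - move=> a b x t f g; apply: subvs_inj; rewrite [RHS]linearP /= !mE.
    exact: modMap_lin.
  - by move=> a x; apply: subvs_inj; rewrite mE modMap_id.
  - by move=> a b c g f x; apply: subvs_inj; rewrite !mE modMap_comp.
pose K := mkmod ml mr m1 mM.
have il a : linear (fun x : K a => vsval x : M a) by move=> t x y;
  rewrite linearP.
have iN a b (f : hom A a b) (x : K a) :
    (vsval (modMap K f x : subvs_of (U b)) : M b) = modMap M f (vsval x).
  by rewrite mkmodE mE.
exists K, (mkhom il iN); split=> [a x|a y].
  by rewrite mkhomE => x0; apply: subvs_inj; rewrite x0 linear0.
split=> [yU|[x <-]]; last by rewrite mkhomE subvsP.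
by exists (vsproj (U a) y); rewrite mkhomE vsprojK.
Qed.

Lemma quotient_exists M (U : forall a, {vspace M a}) :
    (forall a b (f : hom A a b) x, x \in U a -> modMap M f x \in U b) ->
  exists Q (q : modHom M Q), pointwise_surj q
    /\ forall a y, q a y = 0 <-> y \in U a.
Proof.
move=> Us.
pose q a := quot_proj (U a).
have qeq a x y : q a x = q a y <-> x - y \in U a.
  split=> [xy|]; first by apply/quot_proj_eq0;
    rewrite linearB /= -/(q a) xy subrr.
  by move/quot_proj_eq0 => H; apply: subr0_eq; rewrite -linearB.
have qK a y : q a ((q a)^-1%VF y) = y.
  have [x <-] := quot_proj_surj y.
  by rewrite limg_lfunVK // memv_img ?memvf.
pose m a b (f : hom A a b) (y : subvs_of (U a)^C) : subvs_of (U b)^C :=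
  q b (modMap M f ((q a)^-1%VF y)).
have mE a b (f : hom A a b) x : m a b f (q a x) = q b (modMap M f x).
  by apply/qeq; rewrite -linearB; apply: Us; apply/qeq; rewrite qK.
have ex a y : exists x, q a x = y by exists ((q a)^-1%VF y).
have [ml mr m1 mM] : [/\ forall a b (f : hom A a b), linear (m a b f),
    forall a b x, linear (fun f : hom A a b => m a b f x),
    forall a x, m a a (idm A a) x = x
  & forall a b c (g : hom A b c) (f : hom A a b) x,
      m a c (comp g f) x = m b c g (m a b f x)].
  split.
  - move=> a b f t y1 y2; have [x1 <-] := ex a y1; have [x2 <-] := ex a y2.
    by rewrite -linearP !mE !linearP.
  - move=> a b y t f g; have [x <-] := ex a y.
    by rewrite !mE modMap_lin linearP.
  - by move=> a y; have [x <-] := ex a y; rewrite mE modMap_id.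
  - by move=> a b c g f y; have [x <-] := ex a y; rewrite !mE modMap_comp.
pose Q := mkmod ml mr m1 mM.
have ql a : linear (fun x : M a => q a x : Q a) by move=> t x y;
  rewrite linearP.
have qN a b (f : hom A a b) (x : M a) :
    (q b (modMap M f x) : Q b) = modMap Q f (q a x : Q a).
  by rewrite mkmodE mE.
exists Q, (mkhom ql qN); split=> [a y|a y].
  by have [x xE] := ex a y; exists x; rewrite mkhomE.
by rewrite mkhomE; apply: quot_proj_eq0.
Qed.

Lemma kernel_exists M N (u : modHom M N) :
  exists K (i : modHom K M), pointwise_inj i /\ exact_pair i u.
Proof.
have [|K [i [ii iE]]] := @submodule_exists M (fun a => lker (u a)).
  by move=> a b f x; rewrite !memv_ker naturalE => /eqP->; rewrite linear0.
exists K, i; split=> // a y; rewrite -iE memv_ker.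
by split=> [->|/eqP].
Qed.

Lemma cokernel_exists M N (u : modHom M N) :
  exists Q (q : modHom N Q), pointwise_surj q /\ exact_pair u q.
Proof.
have [|Q [q [qs qE]]] := @quotient_exists N (fun a => limg (u a)).
  by move=> a b f x /memv_imgP[y _ ->]; rewrite -naturalE memv_img ?memvf.
exists Q, q; split=> // a y; rewrite qE.
split=> [/memv_imgP[x _ ->]|[x <-]]; first by exists x.
by rewrite memv_img ?memvf.
Qed.

Lemma image_exists M N (u : modHom M N) : exists J (q : modHom M J) (j : modHom
  J N),
  [/\ pointwise_surj q, pointwise_inj j & forall a x, u a x = j a (q a x)].
Proof.
have [|J [j [ji jE]]] := @submodule_exists N (fun a => limg (u a)).
  by move=> a b f x /memv_imgP[y _ ->]; rewrite -naturalE memv_img ?memvf.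
have [|q qE] := @factor_inj J N M j u ji.
  by move=> a z; apply/jE; rewrite memv_img ?memvf.
exists J, q, j; split=> // a y.
have /memv_imgP[x _ xE] : j a y \in limg (u a) by apply/jE; exists y.
by exists x; apply: (pointwise_injP ji); rewrite qE.
Qed.

Lemma epimorphismP M N (p : modHom M N) : epimorphism p <-> pointwise_surj p.
Proof.
split=> [pe a y|ps Z u v puv].
  have [Q [q [_ qE]]] := cokernel_exists p.
  apply/qE; have /(_ _)/eqmodE -> := pe Q q (zerohom N Q).
    exact: zerohomE.
  apply: eqmodI => b x; rewrite !compmodE zerohomE; apply/qE; by exists x.
apply: eqmodI => a y; have [x <-] := ps a y.
by have := eqmodE puv x; rewrite !compmodE.
Qed.

Lemma monomorphismP M N (i : modHom M N) : monomorphism i <-> pointwise_inj i.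
Proof.
split=> [im a x ix|ii Z u v iuv].
  have [K [j [_ jE]]] := kernel_exists i.
  have [y <-] : exists y, j a y = x by apply/jE.
  have /(_ _)/eqmodE -> := im K j (zerohom K M).
    exact: zerohomE.
  by apply: eqmodI => b z; rewrite !compmodE zerohomE linear0; apply/jE;
    exists z.
apply: eqmodI => a x; apply: (pointwise_injP ii).
by have := eqmodE iuv x; rewrite !compmodE.
Qed.

(** The pointwise forms of [is_section] and [is_retraction], which rewrite
    more easily than equations between morphisms. *)
Definition ex_section M N (f : modHom M N) : Prop :=
  exists r : modHom N M, forall a x, r a (f a x) = x.
Definition ex_retraction M N (g : modHom M N) : Prop :=
  exists s : modHom N M, forall a y, g a (s a y) = y.

Lemma is_sectionP M N (f : modHom M N) : is_section f <-> ex_section f.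
Proof.
split=> -[r rf]; exists r; last by apply: eqmodI => a x;
  rewrite compmodE idmodE.
by move=> a x; have := eqmodE rf x; rewrite compmodE idmodE.
Qed.

Lemma is_retractionP M N (g : modHom M N) : is_retraction g <-> ex_retraction g.
Proof.
split=> -[r rf]; exists r; last by apply: eqmodI => a x;
  rewrite compmodE idmodE.
by move=> a x; have := eqmodE rf x; rewrite compmodE idmodE.
Qed.

Lemma short_exact_splits L E N (f : modHom L E) (g : modHom E N) :
  pointwise_inj f -> exact_pair f g -> ex_retraction g -> ex_section f.
Proof.
move=> fi fg [s gs].
have [|r rE] := @factor_inj L E E f (lchom (-1) (compmod s g) (idmod E)) fi.
  move=> a z; apply/fg;
    rewrite lchomE compmodE idmodE scaleN1r linearD linearN /=.
  by rewrite gs addNr.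
exists r => a x; apply: (pointwise_injP fi).
have gf : g a (f a x) = 0 by apply/fg; exists x.
by rewrite rE lchomE compmodE idmodE gf linear0 scaler0 add0r.
Qed.

Lemma short_exact_splits_dual L E N (f : modHom L E) (g : modHom E N) :
  exact_pair f g -> pointwise_surj g -> ex_section f -> ex_retraction g.
Proof.
move=> fg gsj [r rf].
have [|s sE] := @factor_surj E N E g (lchom (-1) (compmod f r) (idmod E)) gsj.
  move=> a _ /fg[x <-]; rewrite lchomE compmodE idmodE rf scaleN1r.
  by rewrite addNr.
exists s => a y; have [x <-] := gsj a y.
rewrite sE lchomE compmodE idmodE scaleN1r linearD linearN /=.
suff -> : g a (f a (r a x)) = 0 by rewrite oppr0 add0r.
by apply/fg; exists (r a x).
Qed.

End Exactness.

(** * Direct sums of two modules *)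

Section DirectSums.
Variables (k : fieldType) (A : homFinCat k).
Implicit Types L M N E X Y Z K : lfdMod A.

Lemma dsumE X Y a b (f : hom A a b) (z : dsum X Y a) :
  modMap (dsum X Y) f z = (modMap X f z.1, modMap Y f z.2).
Proof. by rewrite /= lfunE. Qed.

Fact fsthom_linear X Y a : linear (fun z : dsum X Y a => z.1 : X a).
Proof. by []. Qed.
Fact fsthom_natural X Y a b (f : hom A a b) (z : dsum X Y a) :
  (modMap (dsum X Y) f z).1 = modMap X f z.1.
Proof. by rewrite dsumE. Qed.
Definition fsthom X Y : modHom (dsum X Y) X :=
  mkhom (@fsthom_linear X Y) (@fsthom_natural X Y).

Fact sndhom_linear X Y a : linear (fun z : dsum X Y a => z.2 : Y a).
Proof. by []. Qed.
Fact sndhom_natural X Y a b (f : hom A a b) (z : dsum X Y a) :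
  (modMap (dsum X Y) f z).2 = modMap Y f z.2.
Proof. by rewrite dsumE. Qed.
Definition sndhom X Y : modHom (dsum X Y) Y :=
  mkhom (@sndhom_linear X Y) (@sndhom_natural X Y).

Fact pairhom_linear Z X Y (u : modHom Z X) (v : modHom Z Y) a :
  linear (fun z : Z a => (u a z, v a z) : dsum X Y a).
Proof. by move=> t x y; rewrite !linearP. Qed.
Fact pairhom_natural Z X Y (u : modHom Z X) (v : modHom Z Y) a b
    (f : hom A a b) (z : Z a) :
  ((u b (modMap Z f z), v b (modMap Z f z)) : dsum X Y b)
  = modMap (dsum X Y) f ((u a z, v a z) : dsum X Y a).
Proof. by rewrite dsumE !naturalE. Qed.
Definition pairhom Z X Y (u : modHom Z X) (v : modHom Z Y) : modHom Z (dsum X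
  Y) :=
  mkhom (pairhom_linear u v) (pairhom_natural u v).

Lemma fsthomE X Y a z : fsthom X Y a z = z.1. Proof. exact: mkhomE. Qed.
Lemma sndhomE X Y a z : sndhom X Y a z = z.2. Proof. exact: mkhomE. Qed.
Lemma pairhomE Z X Y (u : modHom Z X) (v : modHom Z Y) a z :
  pairhom u v a z = (u a z, v a z).
Proof. exact: mkhomE. Qed.

Definition copair X Y Z (u : modHom X Z) (v : modHom Y Z) : modHom (dsum X Y) Z :=
  lchom 1 (compmod u (fsthom X Y)) (compmod v (sndhom X Y)).

Lemma copairE X Y Z (u : modHom X Z) (v : modHom Y Z) a z :
  copair u v a z = u a z.1 + v a z.2.
Proof. by rewrite lchomE !compmodE scale1r fsthomE sndhomE. Qed.

Definition inlhom X Y : modHom X (dsum X Y) := pairhom (idmod X) (zerohom X Y).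
Definition inrhom X Y : modHom Y (dsum X Y) := pairhom (zerohom Y X) (idmod Y).

Lemma inlhomE X Y a x : inlhom X Y a x = (x, 0).
Proof. by rewrite pairhomE idmodE zerohomE. Qed.
Lemma inrhomE X Y a y : inrhom X Y a y = (0, y).
Proof. by rewrite pairhomE idmodE zerohomE. Qed.

End DirectSums.
(** * Evaluation at finite families of objects *)

Section Evaluation.
Variables (k : fieldType) (A : homFinCat k).
Implicit Types L M N E X Y Z K : lfdMod A.

(** [ev X s] is [Hom(proj_sum s, X)], by the Yoneda lemma: the values of a
    morphism at the generators of the summands. *)
Fixpoint ev X (s : seq A) : vectType k :=
  if s is a :: s' then (X a * ev X s')%type else 'rV[k]_0.

Section EvMap.
Variables (X Y : lfdMod A) (u : modHom X Y).

Fixpoint ev_fun (s : seq A) : ev X s -> ev Y s :=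
  if s is a :: s' then fun x => (u a x.1, ev_fun x.2) else fun=> 0.

Fact ev_fun_linear s : linear (@ev_fun s).
Proof.
elim: s => [|a s IH] t x y /=; first by rewrite scaler0 addr0.
by rewrite linearP IH.
Qed.

Definition ev_map s : 'Hom(ev X s, ev Y s) := lfun_of (@ev_fun_linear s).

Lemma ev_map_nil x : ev_map nil x = 0. Proof. exact: lfun_ofE. Qed.
Lemma ev_map_cons a s (x : ev X (a :: s)) : ev_map (a :: s) x = (u a x.1,
  ev_map s x.2).
Proof. by rewrite !lfun_ofE. Qed.
End EvMap.

Lemma ev_map_ext X Y (u v : modHom X Y) s x :
  (forall a x, u a x = v a x) -> ev_map u s x = ev_map v s x.
Proof.
move=> uv; elim: s x => [|a s IH] x; first by rewrite !ev_map_nil.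
by rewrite !ev_map_cons uv IH.
Qed.

Lemma ev_map_comp X Y Z (v : modHom Y Z) (u : modHom X Y) s x :
  ev_map (compmod v u) s x = ev_map v s (ev_map u s x).
Proof.
elim: s x => [|a s IH] x; first by rewrite !ev_map_nil.
by rewrite !ev_map_cons compmodE IH.
Qed.

Lemma ev_map_id X s x : ev_map (idmod X) s x = x.
Proof.
elim: s x => [|a s IH] x; first by rewrite ev_map_nil; apply/esym/rowP => -[].
by rewrite ev_map_cons idmodE IH; case: x.
Qed.

Lemma ev_map_zero X Y s x : ev_map (zerohom X Y) s x = 0.
Proof.
elim: s x => [|a s IH] x; first by rewrite ev_map_nil.
by rewrite ev_map_cons zerohomE IH.
Qed.

Lemma ev_map_lc X Y t (u v : modHom X Y) s x :
  ev_map (lchom t u v) s x = t *: ev_map u s x + ev_map v s x.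
Proof.
elim: s x => [|a s IH] x; first by rewrite !ev_map_nil scaler0 addr0.
by rewrite !ev_map_cons lchomE IH.
Qed.

(** [M] is generated by its values at the objects of [s] exactly when no
    nonzero morphism from [M] vanishes at these objects. The dual condition
    holds for the submodules of finite sums of the [inj_mod a] with [a] in
    [s]. *)
Definition generated_on (s : seq A) M : Prop :=
  forall X (u : modHom M X), (forall x, ev_map u s x = 0) ->
    forall a x, u a x = 0.
Definition cogenerated_on (s : seq A) M : Prop :=
  forall X (u : modHom X M), (forall x, ev_map u s x = 0) ->
    forall a x, u a x = 0.

End Evaluation.

(** * Fitting's lemma *)

Section Fitting.
Variables (k : fieldType) (A : homFinCat k).
Implicit Types L M N E X Y Z K : lfdMod A.

Definition iterhom M (phi : modHom M M) n : modHom M M :=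
  iter n (compmod phi) (idmod M).

Lemma iterhomE M (phi : modHom M M) n a x :
  iterhom phi n a x = iter n (phi a) x.
Proof.
elim: n => [|n IH]; first exact: idmodE.
by rewrite /iterhom iterS compmodE -/(iterhom phi n) IH.
Qed.

Lemma ev_map_iter M (phi : modHom M M) n s x :
  ev_map (iterhom phi n) s x = iter_lfun (ev_map phi s) n x.
Proof.
elim: n => [|n IH]; first by rewrite ev_map_id id_lfunE.
by rewrite /iterhom iterS ev_map_comp -/(iterhom phi n) IH /iter_lfun iterS
  comp_lfunE.
Qed.

(** The endomorphism of the finite dimensional space [ev M s] has finite
    Fitting index, and an identity between powers of an endomorphism of [M]
    can be tested on [ev M s]; so one index works at all objects at once. *)
Lemma fitting_index s M (phi : modHom M M) :
    generated_on s M \/ cogenerated_on s M ->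
  exists2 n, (0 < n)%N & forall a x, iterhom phi n a (iterhom phi n a x) = 0 ->
    iterhom phi n a x = 0.
Proof.
have [n n0 [imE kerE]] := iter_img_stabilizes (ev_map phi s).
have iterD2 a x : iterhom phi (n + n) a x = iterhom phi n a (iterhom phi n a x).
  by rewrite !iterhomE iterD.
case=> [genM|cogM]; exists n => // a.
  apply/square_image_kernel => x.
  have [Q [q [qs qE]]] := cokernel_exists (iterhom phi (n + n)).
  have [|y yE] := (qE a (iterhom phi n a x)).1; last by exists y;
    rewrite -iterD2.
  rewrite -compmodE; apply: genM => z; rewrite ev_map_comp ev_map_iter.
  have : iter_lfun (ev_map phi s) n z \in limg (iter_lfun (ev_map phi s) (n +
    n)).
    by rewrite imE memv_img ?memvf.
  case/memv_imgP => w _ ->;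
    rewrite -ev_map_iter -ev_map_comp -(ev_map_zero Q w).
  apply: ev_map_ext => b y; rewrite compmodE zerohomE; apply/qE; by exists y.
move=> x; rewrite -iterD2.
have [K [i [_ iE]]] := kernel_exists (iterhom phi (n + n)).
move/iE => [y <-]; rewrite -compmodE; apply: cogM => z;
  rewrite ev_map_comp ev_map_iter.
apply/eqP; rewrite -memv_ker -kerE memv_ker -ev_map_iter -ev_map_comp.
rewrite -(ev_map_zero M z); apply/eqP; apply: ev_map_ext => b w.
by rewrite compmodE zerohomE; apply/iE; exists w.
Qed.

Lemma indecomposable_complement M K J (i : modHom K M) (j : modHom J M) :
    indecomposable M -> pointwise_inj i -> pointwise_inj j ->
    (forall a x y, i a x = j a y -> i a x = 0) ->
    (forall a z, exists x y, i a x + j a y = z) ->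
  is_zero_mod K \/ is_zero_mod J.
Proof.
move=> [_ indM] ii ji ij0 ijs.
have [||v [vu uv]] := @bijective_isom _ _ _ _ (copair i j).
- move=> a [x y]; rewrite copairE /= => xy0.
  have xE : i a x = j a (- y) by rewrite linearN /=; apply/eqP;
    rewrite -addr_eq0 xy0.
  have x0 := ij0 _ _ _ xE.
  by rewrite (ii _ _ x0); rewrite x0 add0r in xy0; rewrite (ji _ _ xy0).
- by move=> a z; have [x [y xyE]] := ijs a z; exists (x, y); rewrite copairE.
apply: indM; exists v, (copair i j).
by split; apply: eqmodI => a x; rewrite compmodE idmodE.
Qed.

(** Unlike direct sum decompositions, idempotents can be carried through a
    duality without constructing any isomorphism. *)
Lemma indecomposable_idempotent M : indecomposable M <->
  ~ is_zero_mod M /\ forall e : modHom M M, (forall a x, e a (e a x) = e a x) ->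
    (forall a x, e a x = 0) \/ (forall a x, e a x = x).
Proof.
split=> [indM|[M0 idM]].
  split=> [|e ee]; first by case: indM.
  have [K [i [ii iE]]] := kernel_exists e.
  have [J [q [j [qs ji eE]]]] := image_exists e.
  have jE a y : e a (j a y) = j a y.
    by have [x <-] := qs a y; rewrite -eE ee.
  have [||K0|J0] := indecomposable_complement indM ii ji.
  - move=> a x y xy; have ex : e a (i a x) = 0 by apply/iE; exists x.
    by rewrite xy jE -xy in ex.
  - move=> a z; have [|x xE] := (iE a (z - e a z)).1.
      by rewrite linearB /= ee subrr.
    by exists x, (q a z); rewrite xE -eE subrK.
  - right=> a x; have [|y yE] := (iE a (x - e a x)).1.
      by rewrite linearB /= ee subrr.
    by apply/esym/subr0_eq; rewrite -yE (K0 _ y) linear0.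
  - by left=> a x; rewrite eE (J0 _ (q a x)) linear0.
split=> // X Y [u [v [vu uv]]].
have uvE a z : u a (v a z) = z by have := eqmodE uv z; rewrite compmodE idmodE.
pose e := compmod v (compmod (inlhom X Y) (compmod (fsthom X Y) u)).
have eE a x : e a x = v a ((u a x).1, 0).
  by rewrite !compmodE fsthomE inlhomE.
have [a x|e0|e1] := idM e; first by rewrite !eE uvE.
  left=> a x; have := eE a (v a (x, 0)); rewrite e0 uvE => /esym v0.
  by have := uvE a (x, 0); rewrite v0 linear0 => -[].
right=> a y; have := eE a (v a (0, y)); rewrite e1 uvE /= => vE.
by have := uvE a (0, y); rewrite vE uvE => -[].
Qed.

(** [M] is the direct sum of the kernel and of the image of a power of [phi]
    whose exponent is a Fitting index at all objects. *)
Lemma fitting_dichotomy s M (phi : modHom M M) :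
    indecomposable M -> generated_on s M \/ cogenerated_on s M ->
  (pointwise_inj phi /\ pointwise_surj phi) \/
  exists n, forall a x, iterhom phi n a x = 0.
Proof.
move=> indM /(fitting_index phi)[n n0 nE].
have [K [i [ii iE]]] := kernel_exists (iterhom phi n).
have [J [q [j [qs ji jE]]]] := image_exists (iterhom phi n).
have [||K0|J0] := indecomposable_complement indM ii ji.
- move=> a x y xy; have [z zE] := qs a y.
  have : iterhom phi n a (i a x) = 0 by apply/iE; exists x.
  by rewrite xy -zE -jE => /nE.
- move=> a z; have [y yE] := (square_image_kernel (iterhom phi n a)).2 (nE a) z.
  have [|x xE] := (iE a (z - iterhom phi n a y)).1.
    by rewrite linearB /= yE subrr.
  by exists x, (q a y); rewrite -jE xE subrK.
- left; have phi_inj : pointwise_inj phi.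
    move=> a x phix; have [|y <-] := (iE a x).1;
      last by rewrite (K0 a y) linear0.
    by rewrite iterhomE -(prednK n0) iterSr phix -iterhomE linear0.
  by split=> // a; apply: inj_endo_surj; apply: phi_inj.
- by right; exists n => a x; rewrite jE (J0 a (q a x)) linear0.
Qed.

End Fitting.
(** * Finite sums of representable modules *)

Section Projectives.
Variables (k : fieldType) (A : homFinCat k).
Implicit Types L M N E X Y Z K : lfdMod A.

Lemma proj_modE a b c (f : hom A b c) (x : proj_mod a b) :
  modMap (proj_mod a) f x = comp f x.
Proof. by rewrite /= lfunE. Qed.

Fact yoneda_linear X a (x : X a) b :
  linear (fun f : proj_mod a b => modMap X f x).
Proof. exact: modMap_lin. Qed.
Fact yoneda_natural X a (x : X a) b c (f : hom A b c) (g : proj_mod a b) :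
  modMap X (modMap (proj_mod a) f g : hom A a c) x = modMap X f (modMap X g x).
Proof. by rewrite proj_modE modMap_comp. Qed.
Definition yoneda X a (x : X a) : modHom (proj_mod a) X :=
  mkhom (yoneda_linear x) (yoneda_natural x).

Lemma yonedaE X a (x : X a) b (f : hom A a b) : yoneda x b f = modMap X f x.
Proof. exact: mkhomE. Qed.

Lemma proj_mod_projective a X Y (q : modHom X Y) (u : modHom (proj_mod a) Y) :
    pointwise_surj q ->
  exists v : modHom (proj_mod a) X, forall b z, q b (v b z) = u b z.
Proof.
move=> qs; have [x xE] := qs a (u a (idm A a)).
exists (yoneda x) => b f.
by rewrite yonedaE naturalE xE -naturalE proj_modE compm1.
Qed.

(** The value at [z] of the morphism [proj_sum s -> X] that sends the
    generators of the summands to the entries of [x]; so [act x] ranges over the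
    submodule generated by the family [x]. *)
Fixpoint act X s b : ev X s -> proj_sum s b -> X b :=
  match s with
  | nil => fun _ _ => 0
  | a :: s' => fun x z =>
      let z' := z : (hom A a b * proj_sum s' b)%type in
      modMap X z'.1 x.1 + @act X s' b x.2 z'.2
  end.

Lemma act_linear_r X s b (x : ev X s) : linear (@act X s b x).
Proof.
elim: s x => [|a s IH] x t y z /=; first by rewrite scaler0 addr0.
rewrite IH modMap_lin scalerDr -!addrA; congr (_ + _).
by rewrite !addrA; congr (_ + _); rewrite addrC.
Qed.

Lemma act_linear_l X s b (z : proj_sum s b) : linear (fun x => @act X s b x z).
Proof.
elim: s z => [|a s IH] z t x y /=; first by rewrite scaler0 addr0.
rewrite IH linearP scalerDr -!addrA; congr (_ + _).
by rewrite !addrA; congr (_ + _); rewrite addrC.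
Qed.

Lemma act0r X s b (x : ev X s) : act x (0 : proj_sum s b) = 0.
Proof. exact: (linear0 (lin_of (@act_linear_r X s b x))). Qed.

Lemma act0l X s b (z : proj_sum s b) : act (0 : ev X s) z = 0.
Proof. exact: (linear0 (lin_of (act_linear_l z))). Qed.

Lemma act_natural X s b c (f : hom A b c) (x : ev X s) z :
  act x (modMap (proj_sum s) f z) = modMap X f (act x z).
Proof.
elim: s x z => [|a s IH] x z; first by rewrite /= linear0.
have -> : modMap (proj_sum (a :: s)) f z
  = (modMap (proj_mod a) f z.1, modMap (proj_sum s) f z.2) by apply: dsumE.
by rewrite /= IH linearD /= -modMap_comp -proj_modE.
Qed.

Definition hom_of X s (x : ev X s) : modHom (proj_sum s) X :=
  mkhom (fun b => @act_linear_r X s b x) (fun b c f z => act_natural f x z).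

Lemma hom_ofE X s (x : ev X s) b z : hom_of x b z = act x z.
Proof. exact: mkhomE. Qed.

Lemma act_ev_map X Y (u : modHom X Y) s (x : ev X s) b z :
  act (ev_map u s x) z = u b (act x z).
Proof.
elim: s x z => [|a s IH] x z; first by rewrite /= linear0.
by rewrite ev_map_cons /= IH linearD /= naturalE.
Qed.

(** The inverse of [hom_of], see [act_values_of] and [hom_ofK]. *)
Fixpoint values_of X s : modHom (proj_sum s) X -> ev X s :=
  match s with
  | nil => fun _ => 0
  | a :: s' => fun p =>
      (p a (idm A a, 0),
       @values_of X s' (compmod p (inrhom (proj_mod a) (proj_sum s'))))
  end.

Lemma values_of_ext X s (p q : modHom (proj_sum s) X) :
  (forall b z, p b z = q b z) -> values_of p = values_of q.
Proof.
elim: s p q => [//|a s IH] p q pq /=; congr pair; first exact: pq.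
by apply: IH => b z; rewrite !compmodE pq.
Qed.

Lemma act_values_of X s (p : modHom (proj_sum s) X) b z : act (values_of p) z =
  p b z.
Proof.
elim: s p z => [|a s IH] p z.
  have -> : z = 0 by apply/rowP => -[].
  by rewrite linear0.
rewrite /= IH compmodE inrhomE -(naturalE p).
have -> : modMap (proj_sum (a :: s)) z.1 (idm A a, 0) = (z.1, 0).
  by rewrite [LHS]dsumE proj_modE compm1 linear0.
rewrite -linearD; congr (p b _).
by case: z => z1 z2; congr pair; rewrite /= ?addr0 ?add0r.
Qed.

Lemma hom_ofK X s (x : ev X s) : values_of (hom_of x) = x.
Proof.
elim: s x => [|a s IH] x; first by apply/rowP => -[].
case: x => x1 x2; rewrite [LHS]/=; congr pair.
  by rewrite lfun_ofE /= modMap_id act0r addr0.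
rewrite -[RHS]IH; apply: values_of_ext => b z;
  rewrite compmodE inrhomE !hom_ofE /=.
by rewrite linear0 zero_lfunE add0r.
Qed.

Lemma hom_of_inj X s (x y : ev X s) :
  (forall b (z : proj_sum s b), act x z = act y z) -> x = y.
Proof.
move=> xy; rewrite -[x]hom_ofK -[y]hom_ofK; apply: values_of_ext => b z.
by rewrite !hom_ofE xy.
Qed.

Lemma ev_map_values_of X Y (u : modHom X Y) s (p : modHom (proj_sum s) X) :
  ev_map u s (values_of p) = values_of (compmod u p).
Proof.
apply: hom_of_inj => b z; rewrite act_ev_map !act_values_of;
  exact/esym/compmodE.
Qed.

Lemma ev_map_surj X Y (q : modHom X Y) s y :
  pointwise_surj q -> exists x, ev_map q s x = y.
Proof.
move=> qs; elim: s y => [|a s IH] y.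
  by exists 0; apply/rowP => -[].
case: y => y1 y2; have [x1 <-] := qs a y1; have [x2 <-] := IH y2.
by exists (x1, x2); rewrite ev_map_cons.
Qed.

Lemma proj_sum_projective s X Y (q : modHom X Y) (u : modHom (proj_sum s) Y) :
    pointwise_surj q ->
  exists v : modHom (proj_sum s) X, forall b z, q b (v b z) = u b z.
Proof.
move=> qs; have [x xE] := ev_map_surj (values_of u) qs.
by exists (hom_of x) => b z; rewrite hom_ofE -act_ev_map xE act_values_of.
Qed.

Lemma surj_generated_on s M (p : modHom (proj_sum s) M) :
  pointwise_surj p -> generated_on s M.
Proof.
move=> ps X u u0 a x; have [z <-] := ps a x.
have : ev_map u s (values_of p) = 0 by apply: u0.
rewrite ev_map_values_of => /(congr1 (fun c => act c z)).
rewrite act_values_of compmodE => ->.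
exact: act0l.
Qed.

Lemma act_cat M s t (x : ev M s) (y : ev M t) : exists w : ev M (s ++ t),
  forall b z1 z2, exists z, act w z = act x z1 + act y z2 :> M b.
Proof.
elim: s x => [|a s IH] x; first by exists y => b z1 z2; exists z2;
  rewrite add0r.
case: x => x1 x2; have [w wE] := IH x2.
exists (x1, w) => b [f z1] z2; have [z zE] := wE b z1 z2.
by exists (f, z); rewrite /= zE addrA.
Qed.

Lemma elements_generated M a (l : seq (M a)) : exists s (w : ev M s),
  forall x, x \in l -> exists z, act w z = x.
Proof.
elim: l => [|y l [s [w wE]]]; first by exists nil, 0.
exists (a :: s), (y, w) => x; rewrite inE => /predU1P[->|/wE[z zE]].
  exists (idm A a, 0); rewrite /= modMap_id.
  by rewrite act0r addr0.
by exists (0, z); rewrite /= linear0 zero_lfunE add0r.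
Qed.

Lemma values_generated M (l : seq A) : exists s (w : ev M s),
  forall a, List.In a l -> forall x : M a, exists z, act w z = x.
Proof.
elim: l => [|a l [t [y yE]]]; first by exists nil, 0.
have [s [x xE]] := @elements_generated M a (vbasis fullv).
have [w wE] := act_cat x y.
exists (s ++ t), w => b [ab|bl] m; last first.
  have [z2 <-] := yE b bl m; have [z zE] := wE b 0 z2; exists z.
  by rewrite zE act0r add0r.
subst b.
have xs : (fullv <= limg (hom_of x a))%VS.
  rewrite -(span_basis (vbasisP fullv)); apply/span_subvP => v /xE[z <-].
  by rewrite -hom_ofE memv_img ?memvf.
have /memv_imgP[z1 _ ->] := subvP xs m (memvf m).
have [z zE] := wE a z1 0; exists z.
by rewrite zE hom_ofE act0r addr0.
Qed.

Lemma fin_generatedP M :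
  fin_generated M <-> exists s (p : modHom (proj_sum s) M), pointwise_surj p.
Proof. by split=> -[s [p /epimorphismP ps]]; exists s, p. Qed.

End Projectives.
(** * Almost split sequences *)

Section AlmostSplit.
Variables (k : fieldType) (A : homFinCat k).
Implicit Types L M N E X Y Z K : lfdMod A.

Definition lifts_nonretractions E M (g : modHom E M) : Prop :=
  forall X (u : modHom X M), ~ ex_retraction u ->
    exists v : modHom X E, forall a x, g a (v a x) = u a x.

Definition extends_nonsections L E (f : modHom L E) : Prop :=
  forall X (u : modHom L X), ~ ex_section u ->
    exists v : modHom E X, forall a x, v a (f a x) = u a x.

Lemma almost_splitE L E N (f : modHom L E) (g : modHom E N) : almost_split f g
  <->
  [/\ ses f g, ~ ex_retraction g, indecomposable L, indecomposable N
    & extends_nonsections f /\ lifts_nonretractions g].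
Proof.
split=> [[[/short_exactP fg gn] iL iN fl gl]|[fg gn iL iN [fl gl]]].
  split=> //; first by move/is_retractionP.
  split=> X u un.
    have [|v vE] := fl X u; first by move/is_sectionP.
    by exists v => a x; rewrite -compmodE (eqmodE vE).
  have [|v vE] := gl X u; first by move/is_retractionP.
  by exists v => a x; rewrite -compmodE (eqmodE vE).
split=> //.
- by split; [exact/short_exactP|move/is_retractionP].
- move=> X u un; have [|v vE] := fl X u; first by move/is_sectionP.
  by exists v; apply: eqmodI => a x; rewrite compmodE vE.
- move=> X u un; have [|v vE] := gl X u; first by move/is_retractionP.
  by exists v; apply: eqmodI => a x; rewrite compmodE vE.
Qed.

End AlmostSplit.

(** * Ends of almost split sequences are finitely presented *)

Section FinitePresentation.
Variables (k : fieldType) (A : homFinCat k).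
Implicit Types L M N E X Y Z K : lfdMod A.

(** The morphisms [e a : M a -> E a] are required to form a section of [g] only
    over the objects of a finite list. The submodule of [M] generated by its
    values at these objects is proper, its inclusion lifts to [E], and the lift
    is such a partial section. *)
Lemma lifts_nonretractions_fin_generated E M (g : modHom E M) :
  lifts_nonretractions g -> ~ ex_retraction g -> fin_generated M.
Proof.
move=> glift gnr; apply: contrapT => nfg; apply: gnr.
pose V a : vectType k := 'Hom(M a, E a).
pose C (l : seq A) (e : forall a, V a) :=
  (forall a, List.In a l -> forall x, g a (e a x) = x) /\
  (forall a b, List.In a l -> List.In b l -> forall (f : hom A a b) x,
     e b (modMap M f x) = modMap E f (e a x)).
have [||||e eC] := @affine_compactness k A V C.
- move=> l; have [s [w wE]] := values_generated M l.
  have [J [q [j [qs ji jE]]]] := image_exists (hom_of w).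
  have [|v vE] := glift J j.
    case=> r jr; apply: nfg; apply/fin_generatedP; exists s, (hom_of w) => a y.
    by have [z zE] := qs a (r a y); exists z; rewrite jE zE jr.
  have jK a : List.In a l -> forall x, j a ((j a)^-1%VF x) = x.
    move=> al x; rewrite limg_lfunVK //; have [z <-] := wE a al x.
    by rewrite -hom_ofE jE memv_img ?memvf.
  exists (fun a => v a \o (j a)^-1)%VF; split=> [a al x|a b al bl f x].
    by rewrite comp_lfunE vE jK.
  rewrite !comp_lfunE -naturalE; congr (v b _).
  by apply: (pointwise_injP ji); rewrite jK // naturalE jK.
- move=> l e e' ee [Cg Cn]; split=> [a al x|a b al bl f x].
    by rewrite -ee // Cg.
  by rewrite -!ee // Cn.
- move=> l t x y z [xg xn] [yg yn] [zg zn]; split=> [a al w|a b al bl f w].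
    rewrite !(add_lfunE, scale_lfunE, opp_lfunE) linear_affine /=.
    by rewrite zg // xg // yg // subrr scaler0 addr0.
  rewrite !(add_lfunE, scale_lfunE, opp_lfunE) linear_affine /=.
  by rewrite zn // xn // yn.
- move=> l l' e [Cg Cn]; have inl a : List.In a l -> List.In a (l ++ l').
    by move=> al; apply/List.in_app_iff; left.
  have inr a : List.In a l' -> List.In a (l ++ l').
    by move=> al; apply/List.in_app_iff; right.
  by split; split=> *; [apply: Cg|apply: Cn|apply: Cg|apply: Cn]; auto.
have en a b (f : hom A a b) : (e b \o modMap M f = modMap E f \o e a)%VF.
  apply/lfunP => x; rewrite !comp_lfunE.
  by have [_ ->] := eC [:: a; b] => //=; auto.
exists (ModHom en) => a x.
by have [-> //] := eC [:: a]; left.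
Qed.

(** A lift to [E] of the map from the cokernel of [i \o hom_of y] to [M] is a
    morphism [e] with [g \o e = p] that kills the family [y] in the kernel [K]
    of [p]. If every [y] has one, then one [e] kills all of [K] and induces a
    section of [g]. Otherwise the cokernel [Q] of some [y] retracts onto [M],
    through [r] with section [sg]. Then [1 - sg \o r] maps [Q] onto the kernel
    of [r], that is [K] modulo [y], so the family [y] and a lift of
    [q - sg \o p] to [K] together generate [K]. *)
Lemma lifts_nonretractions_fin_presented E M (g : modHom E M) :
  lifts_nonretractions g -> ~ ex_retraction g -> fin_presented M.
Proof.
move=> glift gnr; have := lifts_nonretractions_fin_generated glift gnr.
case/fin_generatedP => s [p ps]; have [K [i [ii iE]]] := kernel_exists p.
have [t [y [Q [q [r [qs [qE [rE rr]]]]]]]] : exists t (y : ev K t) Q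
    (q : modHom (proj_sum s) Q) (r : modHom Q M),
    pointwise_surj q /\ exact_pair (compmod i (hom_of y)) q /\
    (forall b z, r b (q b z) = p b z) /\ ex_retraction r.
  apply: contrapT => none; apply: gnr.
  (* The finitely generated submodules of [K], by finite families of
     generators. *)
  pose mk t (y : ev K t) : {t : seq A & ev K t} := existT _ t y.
  pose S (j : {t : seq A & ev K t}) (e : ev E s) :=
    (forall b z, g b (act e z) = p b z) /\
    (forall b z, act e (i b (act (projT2 j) z)) = 0).
  have [|||e eS] := @directed_affine_point k (ev E s) _ (mk nil 0) S.
  - case=> t y; have [Q [q [qs qE]]] := cokernel_exists (compmod i (hom_of y)).
    have [|r rE] := @factor_surj _ _ _ _ _ q p qs.
      by move=> a _ /qE[z <-]; rewrite compmodE; apply/iE;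
        exists (hom_of y a z).
    have [|v vE] := glift Q r.
      by move=> rr; apply: none; exists t, y, Q, q, r.
    exists (values_of (compmod v q)); split=> b z;
      rewrite act_values_of compmodE.
      by rewrite vE.
    suff -> : q b (i b (act y z)) = 0 by rewrite linear0.
    by apply/qE; exists z; rewrite compmodE hom_ofE.
  - move=> j c e1 e2 e3 [g1 i1] [g2 i2] [g3 i3].
    have actE b z : act (e3 + c *: (e1 - e2)) z
        = act e3 z + c *: (act e1 z - act e2 z) :> E b.
      exact: (linear_affine (lin_of (act_linear_l z))).
    split=> b z; rewrite actE; last by rewrite i1 i2 i3 subrr scaler0 addr0.
    by rewrite linear_affine /= g1 g2 g3 subrr scaler0 addr0.
  - case=> t1 y1 [t2 y2]; have [y yE] := act_cat y1 y2.
    exists (mk (t1 ++ t2) y) => e [ge ie].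
    split; split=> // b z /=.
      by have [w wE] := yE b z 0; have := ie b w; rewrite /= wE act0r addr0.
    by have [w wE] := yE b 0 z; have := ie b w; rewrite /= wE act0r add0r.
  have [|h hE] := @factor_surj _ _ _ _ _ p (hom_of e) ps.
    move=> b _ /iE[x <-]; rewrite hom_ofE.
    have [_ /(_ b (idm A b, 0))] := eS (mk [:: b] (x, 0)).
    by rewrite /= modMap_id addr0.
  exists h => b x; have [z <-] := ps b x.
  by rewrite hE hom_ofE; have [-> _] := eS (mk nil 0).
exists s, p, K, i; split; first exact/short_exactP.
have [sg rs] := rr.
have [w wE] := proj_sum_projective (lchom (-1) (compmod sg p) q) qs.
have {}wE b z : q b (w b z) = q b z - sg b (p b z).
  by rewrite wE lchomE compmodE scaleN1r addrC.
have [|w' w'E] := @factor_inj _ _ _ _ _ i w ii.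
  by move=> b z; apply/iE; rewrite -rE wE linearB /= rE rs subrr.
have [v vE] := act_cat y (values_of w').
apply/fin_generatedP; exists (t ++ s), (hom_of v) => b x.
have [|z zE] := (qE b (i b x - w b (i b x))).1.
  rewrite linearB /= wE; suff -> : p b (i b x) = 0.
    by rewrite linear0 subr0 subrr.
  by apply/iE; exists x.
have [z' z'E] := vE b z (i b x); exists z'; rewrite hom_ofE z'E act_values_of.
apply: (pointwise_injP ii); rewrite linearD /= w'E.
by rewrite compmodE hom_ofE in zE; rewrite zE subrK.
Qed.

End FinitePresentation.
(** * From right to left almost split morphisms *)

Section Pushouts.
Variables (k : fieldType) (A : homFinCat k).
Implicit Types L M N E X Y Z K : lfdMod A.

(** The middle term is the cokernel of [(u, - f) : L -> X + E]. *)
Lemma pushout L E N (f : modHom L E) (g : modHom E N) X (u : modHom L X) :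
    ses f g ->
  exists Y (j : modHom X Y) (w : modHom E Y) (h : modHom Y N),
    [/\ ses j h, forall a x, j a (u a x) = w a (f a x)
      & forall a y, h a (w a y) = g a y].
Proof.
move=> [fi fg gs].
pose phi := pairhom u (lchom (-1) f (zerohom L E)).
have phiE a x : phi a x = (u a x, - f a x).
  by rewrite pairhomE lchomE zerohomE scaleN1r addr0.
have [Y [q [qs qE]]] := cokernel_exists phi.
pose g0 := copair (zerohom X N) g.
have g0E a z : g0 a z = g a z.2 by rewrite copairE zerohomE add0r.
have gf0 a x : g a (f a x) = 0 by apply/fg; exists x.
have [|h hE] := @factor_surj _ _ _ _ _ q g0 qs.
  by move=> a z /qE[x <-]; rewrite g0E phiE linearN /= gf0 oppr0.
have quf a x : q a (u a x, 0) = q a (0, f a x).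
  apply/subr0_eq; rewrite -linearB; apply/qE; exists x; rewrite phiE.
  by congr pair; rewrite /= ?subr0 ?sub0r.
pose j := compmod q (inlhom X E); pose w := compmod q (inrhom X E).
have jE a x : j a x = q a (x, 0) by rewrite compmodE inlhomE.
have wE a x : w a x = q a (0, x) by rewrite compmodE inrhomE.
have juw a x : j a (u a x) = w a (f a x) by rewrite jE wE quf.
have qjw a x e : q a (x, e) = j a x + w a e.
  rewrite jE wE -linearD; congr (q a _).
  by congr pair; rewrite /= ?addr0 ?add0r.
exists Y, j, w, h; split.
- split.
  + move=> a x; rewrite jE => /qE[l]; rewrite phiE => -[<- /eqP].
    by rewrite oppr_eq0 => /eqP/fi->; rewrite linear0.
  + move=> a y; split=> [|[x <-]]; last by rewrite jE hE g0E linear0.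
    have [[x e] <-] := qs a y; rewrite hE g0E => /fg[l /= <-].
    by exists (x + u a l); rewrite qjw linearD /= juw.
  + move=> a y; have [e <-] := gs a y; exists (q a (0, e)).
    by rewrite hE g0E.
- exact: juw.
- by move=> a y; rewrite wE hE g0E.
Qed.

(** A lift to [E] is carried on to [Y]. A splitting of the pushout would give a
    retraction of [Y] onto [X], whose composite with [E -> Y] extends [u]. *)
Lemma pushout_lifts_nonretractions L E N (f : modHom L E) (g : modHom E N) X
    (u : modHom L X) :
    ses f g -> lifts_nonretractions g ->
    ~ (exists v : modHom E X, forall a x, v a (f a x) = u a x) ->
  exists Y (j : modHom X Y) (w : modHom E Y) (h : modHom Y N),
    [/\ ses j h, forall a x, j a (u a x) = w a (f a x),
        forall a y, h a (w a y) = g a y, lifts_nonretractions h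
      & ~ ex_retraction h].
Proof.
move=> fg glift nu; have [Y [j [w [h [jh jw hw]]]]] := pushout u fg.
exists Y, j, w, h; split=> // [Z z /glift[v vE]|hr].
  by exists (compmod w v) => a x; rewrite compmodE hw vE.
case: jh => ji jh _; have [r rj] := short_exact_splits ji jh hr.
by apply: nu; exists (compmod r w) => a x; rewrite compmodE -jw rj.
Qed.

(** If [u] does not extend along [f], the pushout of the sequence along [u]
    does not split, so its right hand map factors through [g]; the factorization
    induces [w' : X -> L]. If the endomorphism [w' \o u] of [L] is invertible,
    [u] is a section; otherwise it is nilpotent, the endomorphism [psi] of [E]
    over [M] that restricts to it has a power killing [L], and that power
    factors through [M] and gives a section of [g]. *)
Lemma lifts_nonretractions_extends L E N (f : modHom L E) (g : modHom E N) s :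
    ses f g -> lifts_nonretractions g -> ~ ex_retraction g ->
    indecomposable L -> cogenerated_on s L ->
  extends_nonsections f.
Proof.
move=> fg glift gnr indL cogL X u nsu; apply: contrapT => nu.
have [Y [j [w [h [[ji jh hs] jw hw hlift hnr]]]]] :=
  pushout_lifts_nonretractions fg glift nu.
have [v vE] := glift Y h hnr.
have [fi fgE _] := fg.
have [|w' w'E] := @factor_inj _ _ _ _ _ f (compmod v j) fi.
  by move=> a z; apply/fgE; rewrite compmodE vE; apply/jh; exists z.
pose phi := compmod w' u.
have phiE a x : f a (phi a x) = v a (w a (f a x)).
  by rewrite compmodE w'E compmodE jw.
have [[phi_inj phi_surj]|[n phi0]] := 
  fitting_dichotomy phi indL (or_intror cogL).
  have [r [rphi _]] := bijective_isom phi_inj phi_surj.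
  apply: nsu; exists (compmod r w') => a x.
  by rewrite compmodE -(compmodE w' u) rphi.
pose psi := compmod v w.
have psif m a x : iterhom psi m a (f a x) = f a (iterhom phi m a x).
  rewrite !iterhomE; elim: m => [//|m IH].
  by rewrite !iterS IH phiE compmodE.
have gpsi m a y : g a (iterhom psi m a y) = g a y.
  rewrite iterhomE; elim: m => [//|m IH].
  by rewrite iterS compmodE vE hw IH.
have [_ _ gs] := fg.
have [|t tE] := @factor_surj _ _ _ _ _ g (iterhom psi n) gs.
  by move=> a _ /fgE[x <-]; rewrite psif phi0 linear0.
by apply: gnr; exists t => a y; have [e <-] := gs a y; rewrite tE gpsi.
Qed.

(** If the kernel decomposes, its identity is the sum of two idempotents, one
    of which does not extend along [f]; pushing out onto the image of that one
    gives a smaller kernel. *)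
Lemma indecomposable_kernel N s n L E (f : modHom L E) (g : modHom E N) :
    (\dim {:ev L s} <= n)%N ->
    ses f g -> lifts_nonretractions g -> ~ ex_retraction g ->
    cogenerated_on s L ->
  exists L' E' (f' : modHom L' E') (g' : modHom E' N),
    [/\ ses f' g', lifts_nonretractions g', ~ ex_retraction g',
        cogenerated_on s L' & indecomposable L'].
Proof.
elim: n L E f g => [|n IH] L E f g.
  move=> dim0 fg glift gnr cogL; case: gnr.
  have [fi fgE gs] := fg; apply: (short_exact_splits_dual fgE gs).
  exists (zerohom E L) => a x; rewrite zerohomE -[RHS]idmodE; apply/esym.
  apply: cogL => z; apply/eqP; rewrite -memv0.
  have /eqP <- : fullv == 0%VS :> {vspace ev L s} by rewrite -dimv_eq0 -leqn0.
  exact: memvf.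
move=> dimS fg glift gnr cogL; have [fi fgE gs] := fg.
have [indL|ndec] := pselect (indecomposable L).
  by exists L, E, f, g.
have step (e : modHom L L) : (forall a x, e a (e a x) = e a x) ->
    ~ (forall a x, e a x = x) ->
    ~ (exists v : modHom E L, forall a x, v a (f a x) = e a x) ->
  exists L' E' (f' : modHom L' E') (g' : modHom E' N),
    [/\ ses f' g', lifts_nonretractions g', ~ ex_retraction g',
        cogenerated_on s L' & indecomposable L'].
  move=> ee e1 ne; have [J [q [j [qs ji eE]]]] := image_exists e.
  have qj a y : q a (j a y) = y.
    have [x <-] := qs a y; apply: (pointwise_injP ji).
    by rewrite -!eE ee.
  have nq : ~ (exists v : modHom E J, forall a x, v a (f a x) = q a x).
    by case=> v vE; apply: ne; exists (compmod j v) => a x;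
      rewrite compmodE vE eE.
  have [Y [f' [_ [g' [f'g' _ _ g'lift g'nr]]]]] :=
    pushout_lifts_nonretractions fg glift nq.
  have cogJ : cogenerated_on s J.
    move=> X u u0 a x; apply: (ji a); rewrite -compmodE.
    by apply: cogL => z; rewrite ev_map_comp u0 linear0.
  apply: (IH J Y f' g') => //; rewrite -ltnS; apply: leq_trans dimS.
  have evqj y : ev_map q s (ev_map j s y) = y.
    by rewrite -ev_map_comp -[RHS]ev_map_id; apply: ev_map_ext => a z;
      rewrite compmodE idmodE qj.
  have kerj : lker (ev_map j s) = 0%VS.
    by apply: ker0_inj => y y0; rewrite -[y]evqj y0 linear0.
  have dimJ : \dim (limg (ev_map j s)) = \dim {:ev J s}.
    by rewrite limg_dim_eq // kerj capv0.
  rewrite -dimJ ltn_neqAle dimvS ?subvf // andbT; apply/negP => /eqP dimE.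
  have imE : limg (ev_map j s) = fullv by apply/eqP;
    rewrite eqEdim subvf dimE leqnn.
  apply: e1 => a x; apply/esym/subr0_eq.
  pose d := lchom (-1) e (idmod L).
  have dE b z : d b z = z - e b z by rewrite lchomE idmodE scaleN1r addrC.
  rewrite -dE; apply: cogL => z.
  have /memv_imgP[y _ ->] : z \in limg (ev_map j s) by rewrite imE memvf.
  rewrite -ev_map_comp -(ev_map_zero L y); apply: ev_map_ext => b y'.
  by rewrite compmodE dE zerohomE eE qj subrr.
have L0 : ~ is_zero_mod L.
  move=> L0; apply: gnr; apply: (short_exact_splits_dual fgE gs).
  by exists (zerohom E L) => a x; rewrite zerohomE (L0 a x).
have [e [ee e0 e1]] : exists e : modHom L L, [/\ forall a x, e a (e a x) = e a
  x,
    ~ (forall a x, e a x = 0) & ~ (forall a x, e a x = x)].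
  apply: contrapT => none; apply: ndec; apply/indecomposable_idempotent;
    split=> // e ee.
  by apply: contrapT => /not_orP[e0 e1]; apply: none; exists e.
have [[v vE]|ne] := pselect (exists v : modHom E L, forall a x, v a (f a x) = e
  a x);
  last exact: (step e).
pose d := lchom (-1) e (idmod L).
have dE b z : d b z = z - e b z by rewrite lchomE idmodE scaleN1r addrC.
apply: (step d) => [a x|d1|[v' v'E]].
- by rewrite !dE linearB /= ee subrr subr0.
- by apply: e0 => a x; have := d1 a x;
    rewrite dE => /(canRL (subrK _))/esym/eqP;
    rewrite -subr_eq0 addrC addKr => /eqP.
apply: gnr; apply: (short_exact_splits_dual fgE gs).
exists (lchom 1 v v') => a x.
by rewrite lchomE scale1r vE v'E dE addrC subrK.
Qed.

End Pushouts.
(** * The Nakayama functor *)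

Section Nakayama.
Variables (k : fieldType) (A : homFinCat k).
Implicit Types L M N E X Y Z K : lfdMod A.

Fact prehom_linear b c (f : hom A b c) d :
  linear (fun g : proj_mod c d => comp g f : proj_mod b d).
Proof. exact: comp_linear_l. Qed.
Fact prehom_natural b c (f : hom A b c) d e (h : hom A d e) (g : proj_mod c d) :
  (comp (modMap (proj_mod c) h g : hom A c e) f : proj_mod b e)
  = modMap (proj_mod b) h (comp g f : proj_mod b d).
Proof. by rewrite !proj_modE compA. Qed.
Definition prehom b c (f : hom A b c) : modHom (proj_mod c) (proj_mod b) :=
  mkhom (prehom_linear f) (prehom_natural f).

Lemma prehomE b c (f : hom A b c) d (g : hom A c d) : prehom f d g = comp g f.
Proof. exact: mkhomE. Qed.

Lemma yoneda_modMap X b c (f : hom A b c) (x : X b) s y :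
  ev_map (yoneda (modMap X f x)) s y = ev_map (yoneda x) s (ev_map (prehom f) s
    y).
Proof.
rewrite -ev_map_comp; apply: ev_map_ext => d g.
by rewrite compmodE !yonedaE prehomE modMap_comp.
Qed.

Lemma yoneda_hom X Y (u : modHom X Y) b (x : X b) s y :
  ev_map (yoneda (u b x)) s y = ev_map u s (ev_map (yoneda x) s y).
Proof.
by rewrite -ev_map_comp; apply: ev_map_ext => d g;
  rewrite compmodE !yonedaE naturalE.
Qed.

Lemma yoneda_lc X b t (x y : X b) s z :
  ev_map (yoneda (t *: x + y)) s z
  = t *: ev_map (yoneda x) s z + ev_map (yoneda y) s z.
Proof.
by rewrite -ev_map_lc; apply: ev_map_ext => d g;
  rewrite lchomE !yonedaE linearP.
Qed.

Section Nu.
Variable s : seq A.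

Definition nu_map b c (f : hom A b c) (phi : 'Hom(ev (proj_mod b) s, k^o)) :
    'Hom(ev (proj_mod c) s, k^o) := (phi \o ev_map (prehom f) s)%VF.

Fact nu_map_linear b c (f : hom A b c) : linear (nu_map f).
Proof. by move=> t x y; rewrite /nu_map comp_lfunDl comp_lfunZl. Qed.

Fact nu_map_linear_r b c (phi : 'Hom(ev (proj_mod b) s, k^o)) :
  linear (fun f : hom A b c => nu_map f phi).
Proof.
move=> t f g; apply/lfunP => y.
rewrite add_lfunE scale_lfunE !comp_lfunE -linearP -ev_map_lc; congr (phi _).
by apply: ev_map_ext => d h; rewrite lchomE !prehomE comp_linear_r.
Qed.

Fact nu_map1 b (phi : 'Hom(ev (proj_mod b) s, k^o)) : nu_map (idm A b) phi =
  phi.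
Proof.
apply/lfunP => y; rewrite comp_lfunE -[in RHS](ev_map_id y); congr (phi _).
by apply: ev_map_ext => d g; rewrite prehomE compm1 idmodE.
Qed.

Fact nu_mapM a b c (g : hom A b c) (f : hom A a b)
    (phi : 'Hom(ev (proj_mod a) s, k^o)) :
  nu_map (comp g f) phi = nu_map g (nu_map f phi).
Proof.
apply/lfunP => y; rewrite !comp_lfunE -ev_map_comp; congr (phi _).
by apply: ev_map_ext => d h; rewrite compmodE !prehomE compA.
Qed.

(** The Nakayama functor at [P = proj_sum s]: its value at [b] is the dual of
    [Hom(P, proj_mod b)], which is a finite sum of spaces [Hom(b, a)]. *)
Definition nu : lfdMod A := mkmod nu_map_linear nu_map_linear_r nu_map1 nu_mapM.

Lemma nuE b c (f : hom A b c) (phi : nu b) :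
  modMap nu f phi = nu_map f phi.
Proof. exact: mkmodE. Qed.
End Nu.

Definition hom_to_nu_fun X s (lam : 'Hom(ev X s, k^o)) b (x : X b) : nu s b :=
  (lam \o ev_map (yoneda x) s)%VF.

Fact hom_to_nu_linear X s (lam : 'Hom(ev X s, k^o)) b : linear (@hom_to_nu_fun
  X s lam b).
Proof.
move=> t x y; apply/lfunP => z.
by rewrite add_lfunE scale_lfunE !comp_lfunE yoneda_lc linearP.
Qed.

Fact hom_to_nu_natural X s (lam : 'Hom(ev X s, k^o)) b c (f : hom A b c) (x : X
  b) :
  hom_to_nu_fun lam (modMap X f x) = modMap (nu s) f (hom_to_nu_fun lam x).
Proof.
rewrite nuE; apply/lfunP => y.
by rewrite !comp_lfunE yoneda_modMap.
Qed.

(** With [hom_to_nu_surj] and [hom_to_nu_inj], this is the natural isomorphism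
    between [D Hom(proj_sum s, X)] and [Hom(X, nu s)]. *)
Definition hom_to_nu X s (lam : 'Hom(ev X s, k^o)) : modHom X (nu s) :=
  mkhom (hom_to_nu_linear lam) (hom_to_nu_natural lam).

Lemma hom_to_nuE X s (lam : 'Hom(ev X s, k^o)) b (x : X b) y :
  (hom_to_nu lam b x : 'Hom(_, _)) y = lam (ev_map (yoneda x) s y).
Proof. by rewrite mkhomE comp_lfunE. Qed.

Lemma hom_to_nu_comp X Y (u : modHom X Y) s (lam : 'Hom(ev Y s, k^o)) b x :
  hom_to_nu lam b (u b x) = hom_to_nu (lam \o ev_map u s)%VF b x.
Proof. by apply/lfunP => y; rewrite !hom_to_nuE comp_lfunE yoneda_hom. Qed.

Lemma hom_to_nu_inj X s (lam mu : 'Hom(ev X s, k^o)) :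
  (forall b x, hom_to_nu lam b x = hom_to_nu mu b x) -> lam = mu.
Proof.
move=> eqlm; have {eqlm} : forall b (x : X b) y,
    lam (ev_map (yoneda x) s y) = mu (ev_map (yoneda x) s y).
  by move=> b x y; rewrite -!hom_to_nuE eqlm.
elim: s lam mu => [|a s IH] lam mu eqlm; apply/lfunP => x.
  have -> : x = 0 by apply/rowP => -[].
  by rewrite !linear0.
pose inr : {linear ev X s -> ev X (a :: s)} :=
  lin_of (fun t (y z : ev X s) =>
    congr2 pair (esym (etrans (addr0 _) (scaler0 _ t))) erefl
    : (0, t *: y + z) = t *: (0, y) + (0, z) :> ev X (a :: s)).
have E0 : (lam \o linfun inr)%VF = (mu \o linfun inr)%VF.
  apply: IH => b x' y; rewrite !comp_lfunE [linfun inr _]lfunE /=.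
  by have := eqlm b x' (0, y); rewrite ev_map_cons yonedaE linear0 zero_lfunE.
case: x => x1 x2.
have -> : (x1, x2) = ev_map (yoneda x1) (a :: s) (idm A a, 0) + inr x2.
  rewrite ev_map_cons yonedaE modMap_id linear0; congr pair.
    by rewrite /= addr0.
  by rewrite /= add0r.
rewrite !linearD; congr (_ + _); first exact: (eqlm a x1 (idm A a, 0)).
by have /lfunP/(_ x2) := E0; rewrite !comp_lfunE !lfunE.
Qed.

(** The functional is read off from the values of [psi] at the generators of
    the summands, that is, at the identities. *)
Lemma natural_functional X s (psi : forall b, X b -> ev (proj_mod b) s -> k^o) :
    (forall b y, linear (fun x => psi b x y)) ->
    (forall b x, linear (psi b x)) ->
    (forall b c (f : hom A b c) x y,
       psi c (modMap X f x) y = psi b x (ev_map (prehom f) s y)) ->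
  exists lam : 'Hom(ev X s, k^o),
    forall b x y, psi b x y = lam (ev_map (yoneda x) s y).
Proof.
elim: s psi => [|a s IH] psi psil psir psiN.
  exists 0 => b x y; rewrite zero_lfunE.
  have -> : y = 0 by apply/rowP => -[].
  exact: (linear0 (lin_of (psir b x))).
pose z1 : ev (proj_mod a) (a :: s) := (idm A a, 0).
have [|||lam lamE] := IH (fun b x y => psi b x (0, y)).
- by move=> b y t x x'; rewrite psil.
- move=> b x t y y'; rewrite -psir; congr (psi b x _).
  by congr pair; rewrite /= scaler0 addr0.
- move=> b c f x y; rewrite psiN ev_map_cons prehomE; congr (psi b x (_, _)).
  exact: (linear0 (lin_of (comp_linear_l f))).
have fl : linear (fun x : ev X (a :: s) => psi a x.1 z1 + lam x.2 : k^o).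
  move=> t x y; rewrite psil linearP scalerDr -!addrA; congr (_ + _).
  by rewrite addrCA.
exists (lfun_of fl) => b x [f y];
  rewrite lfun_ofE ev_map_cons yonedaE -lamE psiN.
rewrite -(linearD (lin_of (psir b x))); congr (psi b x _).
rewrite ev_map_cons prehomE comp1m linear0; congr pair.
  by rewrite /= addr0.
by rewrite /= add0r.
Qed.

Lemma hom_to_nu_surj X s (psi : modHom X (nu s)) :
  exists lam, forall b x, psi b x = hom_to_nu lam b x.
Proof.
have [|||lam lamE] := @natural_functional X s
  (fun b x y => (psi b x : 'Hom(ev (proj_mod b) s, k^o)) y).
- by move=> b y t x x'; rewrite linearP add_lfunE scale_lfunE.
- by move=> b x t y y'; rewrite linearP.
- by move=> b c f x y; rewrite naturalE nuE comp_lfunE.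
by exists lam => b x; apply/lfunP => y; rewrite hom_to_nuE lamE.
Qed.

Section Transpose.
Variables (s t : seq A) (d : modHom (proj_sum t) (proj_sum s)).

Definition pull_fun X (x : ev X s) : ev X t := values_of (compmod (hom_of x) d).

Lemma act_pull_fun X (x : ev X s) b z : act (pull_fun x) z = act x (d b z).
Proof. by rewrite act_values_of compmodE hom_ofE. Qed.

Fact pull_fun_linear X : linear (@pull_fun X).
Proof.
move=> c x y; apply: hom_of_inj => b z.
by rewrite act_linear_l !act_pull_fun act_linear_l.
Qed.

(** Precomposition with [d], as a linear map from [Hom(proj_sum s, X)] to
    [Hom(proj_sum t, X)]. *)
Definition pull X : 'Hom(ev X s, ev X t) := lfun_of (@pull_fun_linear X).

Lemma act_pull X (x : ev X s) b z : act (pull X x) z = act x (d b z).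
Proof. by rewrite lfun_ofE act_pull_fun. Qed.

Lemma ev_map_pull X Y (u : modHom X Y) (x : ev X s) :
  ev_map u t (pull X x) = pull Y (ev_map u s x).
Proof. by apply: hom_of_inj => b z;
  rewrite act_ev_map !act_pull act_ev_map. Qed.

Fact nu_hom_linear b : linear (fun phi : nu t b =>
  ((phi : 'Hom(ev (proj_mod b) t, k^o)) \o pull (proj_mod b))%VF : nu s b).
Proof. by move=> c x y; rewrite comp_lfunDl comp_lfunZl. Qed.

Fact nu_hom_natural b c (f : hom A b c) (phi : nu t b) :
  ((modMap (nu t) f phi : 'Hom(ev (proj_mod c) t, k^o)) \o pull (proj_mod c))%VF
  = modMap (nu s) f
      ((phi : 'Hom(ev (proj_mod b) t, k^o)) \o pull (proj_mod b))%VF.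
Proof.
by rewrite !nuE; apply/lfunP => y; rewrite !comp_lfunE ev_map_pull.
Qed.

(** The image of [d] under the Nakayama functor. *)
Definition nu_hom : modHom (nu t) (nu s) := mkhom nu_hom_linear nu_hom_natural.

Lemma nu_homE b (phi : nu t b) y : (nu_hom b phi : 'Hom(_, _)) y
  = (phi : 'Hom(ev (proj_mod b) t, k^o)) (pull (proj_mod b) y).
Proof. by rewrite mkhomE comp_lfunE. Qed.

Lemma nu_hom_comp X (lam : 'Hom(ev X t, k^o)) b x :
  nu_hom b (hom_to_nu lam b x) = hom_to_nu (lam \o pull X)%VF b x.
Proof.
by apply/lfunP => y; rewrite nu_homE !hom_to_nuE comp_lfunE ev_map_pull.
Qed.

End Transpose.

(** The inclusion is [hom_to_nu lam] for a functional [lam] on [ev L s], so its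
    composite with [u] depends only on [ev_map u s]. *)
Lemma submodule_of_nu_cogenerated s L (l : modHom L (nu s)) :
  pointwise_inj l -> cogenerated_on s L.
Proof.
move=> li X u u0 a x; have [lam lamE] := hom_to_nu_surj l.
apply: (li a); rewrite lamE; apply/lfunP => y.
by rewrite hom_to_nuE yoneda_hom u0 linear0 zero_lfunE.
Qed.

End Nakayama.

(** * Almost split sequences ending in finitely presented modules *)

Section Existence.
Variables (k : fieldType) (A : homFinCat k).
Implicit Types L M N E X Y Z K : lfdMod A.

(** Multiplying by the inverse of [t r + r'], one gets two endomorphisms with
    sum [1]; the first one is nilpotent by Fitting's lemma, so the second one
    is injective. *)
Lemma nonunits_lc s M t (r r' : modHom M M) :
    indecomposable M -> generated_on s M ->
    ~ pointwise_inj r -> ~ pointwise_inj r' -> ~ pointwise_inj (lchom t r r').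
Proof.
move=> indM genM rn r'n rri.
have rrs : pointwise_surj (lchom t r r').
  by move=> a; apply: inj_endo_surj; apply: rri.
have [w [wrr _]] := bijective_isom rri rrs.
pose rho := lchom t (compmod w r) (zerohom M M).
have rhoE a x : rho a x = t *: w a (r a x).
  by rewrite lchomE compmodE zerohomE addr0.
have [[rhoi _]|[n rho0]] := fitting_dichotomy rho indM (or_introl genM).
  by apply: rn => a x rx; apply: (rhoi a); rewrite rhoE rx linear0 scaler0.
apply: r'n => a x r'x; rewrite -(rho0 a x) iterhomE.
elim: n {rho0} => [//|n IH]; rewrite iterSr.
suff -> : rho a x = x by [].
by rewrite rhoE -linearZ_LR -[RHS]wrr lchomE r'x addr0.
Qed.

(** Let [P1 -> P0 -> M -> 0] be a presentation, with [P0 = proj_sum s] and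
    generators [x0] of [M]. The Nakayama functor [nu] sends it to a map
    [nu t -> nu s] with kernel [L], and a functional [h] on
    [ev M s = Hom(P0, M)] defines a map [M -> nu s]. If [h] kills the images of
    [x0] under the non-invertible endomorphisms and [h x0 = 1], then the
    pullback of [nu t -> nu s] along this map is the required extension:
    a map [u : X -> M] lifts to it if and only if [h] vanishes on the images of
    [x0] under all the composites [u v] with [v : M -> X]. *)
Lemma fin_presented_extension M :
    indecomposable M -> ~ projective_mod M -> fin_presented M ->
  exists L E (f : modHom L E) (g : modHom E M) s,
    [/\ ses f g, lifts_nonretractions g, ~ ex_retraction g & cogenerated_on s
      L].
Proof.
move=> indM npM [s [p [K [i [/short_exactP[ii iE ps] /fin_generatedP[t [q
  qs]]]]]]].
pose d := compmod i q; pose x0 := values_of p.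
have genM := surj_generated_on ps.
have homs X (z : ev X s) : pull d X z = 0 ->
    exists v : modHom M X, ev_map v s x0 = z.
  move=> z0; have [|v vE] := @factor_surj _ _ _ _ _ p (hom_of z) ps.
    move=> b _ /iE[x <-]; have [y <-] := qs b x.
    by rewrite hom_ofE -compmodE -act_pull z0 act0l.
  by exists v; apply: hom_of_inj => b w;
    rewrite act_ev_map act_values_of vE hom_ofE.
(* The composites of [p] with the non-invertible endomorphisms of [M]. *)
pose R z := exists2 r : modHom M M, ~ pointwise_inj r & z = ev_map r s x0.
have [||U UE] := @subspace_of_pred _ (ev M s) R.
- exists (zerohom M M); last by rewrite ev_map_zero.
  by move=> zi; case: indM => + _; apply => a x; apply: (zi a);
    rewrite zerohomE.
- move=> c z z' [r rn ->] [r' r'n ->].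
  by exists (lchom c r r'); [apply: (nonunits_lc indM genM)|rewrite ev_map_lc].
have x0U : x0 \notin U.
  apply/negP => /UE[r rn x0E]; apply: rn => a x; have [z <-] := ps a x.
  by rewrite -act_values_of -act_ev_map -x0E.
have [h [h0 h1]] := separating_functional x0U.
(* The composites with [u] of the morphisms [M -> X] are not invertible, so
   [h] vanishes on them; they are the image under [u] of the kernel of the
   restriction from [Hom(P0, X)] to [Hom(P1, X)]. *)
have lifting X (u : modHom X M) : ~ ex_retraction u ->
    exists lam : 'Hom(ev X t, k^o),
      forall z, lam (pull d X z) = h (ev_map u s z).
  move=> unr; have [|lam lamE] :=
    @lfun_factor _ _ _ _ (pull d X) (h \o ev_map u s)%VF.
    move=> z /homs[v <-]; rewrite comp_lfunE -ev_map_comp; apply: h0; apply/UE.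
    exists (compmod u v) => // uvi; apply: unr.
    have uvs : pointwise_surj (compmod u v).
      by move=> a; apply: inj_endo_surj; apply: uvi.
    have [w [_ uvw]] := bijective_isom uvi uvs.
    by exists (compmod v w) => a y; rewrite compmodE -compmodE uvw.
  by exists lam => z; rewrite lamE comp_lfunE.
pose nd := nu_hom d.
pose del := copair (hom_to_nu h) (lchom (-1) nd (zerohom (nu t) (nu s))).
have delE a z : del a z = hom_to_nu h a z.1 - nd a z.2.
  by rewrite copairE lchomE zerohomE addr0 scaleN1r.
have [E [e [ei eE]]] := kernel_exists del.
have [L [l [li lE]]] := kernel_exists nd.
have [|f fE] := @factor_inj _ _ _ _ _ e (compmod (inrhom M (nu t)) l) ei.
  move=> a z; apply/eE; rewrite delE compmodE inrhomE /= linear0 sub0r.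
  by apply/eqP; rewrite oppr_eq0; apply/eqP/lE; exists z.
pose g := compmod (fsthom M (nu t)) e.
have gE a y : g a y = (e a y).1 by rewrite compmodE fsthomE.
have lift X (u : modHom X M) (psi : modHom X (nu t)) :
    (forall a x, nd a (psi a x) = hom_to_nu h a (u a x)) ->
  exists v : modHom X E, forall a x, g a (v a x) = u a x.
  move=> psiE; have [|v vE] := @factor_inj _ _ _ _ _ e (pairhom u psi) ei.
    by move=> a z; apply/eE; rewrite delE pairhomE /= psiE subrr.
  by exists v => a x; rewrite gE vE pairhomE.
have glift : lifts_nonretractions g.
  move=> X u /lifting[lam lamE]; apply: (lift X u (hom_to_nu lam)) => a x.
  rewrite nu_hom_comp hom_to_nu_comp; apply/lfunP => y.
  by rewrite !hom_to_nuE !comp_lfunE lamE.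
exists L, E, f, g, t; split=> //; last exact: submodule_of_nu_cogenerated li.
  split.
  - move=> a x fx; apply: (li a).
    by have := fE a x; rewrite fx linear0 compmodE inrhomE => -[].
  - move=> a y; split=> [gy|[x <-]]; last by rewrite gE fE compmodE inrhomE.
    have [|x xE] := (lE a (e a y).2).1.
      have /eqP : del a (e a y) = 0 by apply/eE; exists y.
      by rewrite delE -gE gy linear0 sub0r oppr_eq0 => /eqP.
    exists x; apply: (pointwise_injP ei); rewrite fE compmodE inrhomE xE.
    by rewrite gE in gy; case: (e a y) gy => y1 y2 /= ->.
  - move=> a x; have [|v vE] := glift _ (yoneda x).
      case=> r rE; apply: npM => X Y w u /epimorphismP ws.
      have [v vE] := proj_mod_projective (compmod u (yoneda x)) ws.
      exists (compmod v r); apply: eqmodI => b z.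
      by rewrite !compmodE vE compmodE rE.
    by exists (v a (idm A a)); rewrite vE yonedaE modMap_id.
(* A section of [g] would express [h] through the restriction along [d], which
   kills [x0] because [p \o d = 0]. *)
case=> r gr; have [lam lamE] :=
  hom_to_nu_surj (compmod (sndhom M (nu t)) (compmod e r)).
have hE : h = (lam \o pull d M)%VF.
  apply: hom_to_nu_inj => b x; rewrite -nu_hom_comp -lamE !compmodE sndhomE.
  have /eqP : del b (e b (r b x)) = 0 by apply/eE; exists (r b x).
  by rewrite delE -gE gr subr_eq0 => /eqP.
have : pull d M x0 = 0.
  apply: hom_of_inj => b z; rewrite act_pull act_values_of act0l compmodE.
  by apply/iE; exists (q b z).
move=> x00; move: h1; rewrite hE comp_lfunE x00 linear0 => /esym/eqP.
by rewrite oner_eq0.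
Qed.

Theorem almost_split_ending_fin_presented M :
    indecomposable M -> ~ projective_mod M ->
  almost_split_ending M <-> fin_presented M.
Proof.
move=> indM npM; split=> [[L [E [f [g]]]]|fpM].
  case/almost_splitE=> _ gnr _ _ [_ glift].
  exact: lifts_nonretractions_fin_presented glift gnr.
have [L0 [E0 [f0 [g0 [s [f0g0 g0l g0n cogL0]]]]]] :=
  fin_presented_extension indM npM fpM.
have [L [E [f [g [fg gl gn cogL indL]]]]] :=
  indecomposable_kernel (leqnn _) f0g0 g0l g0n cogL0.
exists L, E, f, g; apply/almost_splitE; split=> //; split=> //.
exact: lifts_nonretractions_extends fg gl gn indL cogL.
Qed.

End Existence.

(** * Perfect pairings *)

Section PerfectPairings.
Variable k : fieldType.
Implicit Types V W : vectType k.

(** Nondegeneracy on both sides; as the spaces are finite dimensional, every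
    functional is then represented ([perfect_represents]). *)
Definition perfect (V W : vectType k) (beta : V -> W -> k^o) : Prop :=
  [/\ forall w, linear (fun v => beta v w), forall v, linear (beta v),
      forall v, (forall w, beta v w = 0) -> v = 0
    & forall w, (forall v, beta v w = 0) -> w = 0].

Lemma perfect0l V W (beta : V -> W -> k^o) w : perfect beta -> beta 0 w = 0.
Proof. by case=> bl _ _ _; apply: (linear0 (lin_of (bl w))). Qed.

Lemma perfect0r V W (beta : V -> W -> k^o) v : perfect beta -> beta v 0 = 0.
Proof. by case=> _ br _ _; apply: (linear0 (lin_of (br v))). Qed.

Lemma perfect_flip V W (beta : V -> W -> k^o) :
  perfect beta -> perfect (fun w v => beta v w).
Proof. by case. Qed.

Lemma perfect_curry V W (beta : V -> W -> k^o) : perfect beta ->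
  exists F : 'Hom(V, 'Hom(W, k^o)), (forall v w, F v w = beta v w)
    /\ lker F = 0%VS.
Proof.
case=> bl br b0 _.
have Fl : linear (fun v => lfun_of (br v) : 'Hom(W, k^o)).
  move=> t x y; apply/lfunP => w.
  by rewrite add_lfunE scale_lfunE !lfun_ofE bl.
have FE v w : lfun_of Fl v w = beta v w by rewrite !lfun_ofE.
exists (lfun_of Fl); split=> //; apply: ker0_inj => v v0.
by apply: b0 => w; rewrite -FE v0 zero_lfunE.
Qed.

Lemma dim_dual (V : vectType k) : \dim {:'Hom(V, k^o)} = \dim {:V}.
Proof. by rewrite !dimvf /dim /= muln1. Qed.

Lemma perfect_dim V W (beta : V -> W -> k^o) :
  perfect beta -> (\dim {:V} <= \dim {:W})%N.
Proof.
move=> /perfect_curry[F [_ F0]].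
by rewrite -(dim_dual W) -(@limg_dim_eq _ _ _ F fullv) ?F0 ?capv0 // dimvS
  ?subvf.
Qed.

Lemma perfect_represents V W (beta : V -> W -> k^o) (phi : 'Hom(W, k^o)) :
  perfect beta -> exists v, forall w, beta v w = phi w.
Proof.
move=> pb; have [F [FE F0]] := perfect_curry pb.
have : phi \in limg F.
  suff -> : limg F = fullv by apply: memvf.
  apply/eqP; rewrite eqEdim subvf limg_dim_eq ?F0 ?capv0 // dim_dual.
  exact: perfect_dim (perfect_flip pb).
by case/memv_imgP => v _ ->; exists v => w; rewrite FE.
Qed.

Lemma adjoint_exists (V1 W1 V2 W2 : vectType k) (b1 : V1 -> W1 -> k^o) (b2 : V2
  -> W2 -> k^o)
    (v : 'Hom(W2, W1)) : perfect b1 -> perfect b2 ->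
  exists u : 'Hom(V1, V2), forall x y, b2 (u x) y = b1 x (v y).
Proof.
move=> p1 p2; have [F [FE F0]] := perfect_curry p2.
have [l1 r1 _ _] := p1.
have ex x : exists z, forall y, b2 z y = b1 x (v y).
  have [z zE] := perfect_represents (lfun_of (r1 x) \o v)%VF p2.
  by exists z => y; rewrite zE comp_lfunE lfun_ofE.
pose u x := projT1 (cid (ex x)).
have uE x y : b2 (u x) y = b1 x (v y) by rewrite /u; case: cid.
have ul : linear u.
  move=> t x x'; have [l2 _ n2 _] := p2.
  apply: subr0_eq; apply: n2 => y.
  have -> : u (t *: x + x') - (t *: u x + u x')
      = (-1) *: (t *: u x + u x') + u (t *: x + x').
    by rewrite scaleN1r addrC.
  by rewrite l2 l2 !uE l1 scaleN1r addNr.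
by exists (lfun_of ul) => x y; rewrite lfun_ofE uE.
Qed.

Section Adjoints.
Variables (V1 W1 V2 W2 : vectType k).
Variables (b1 : V1 -> W1 -> k^o) (b2 : V2 -> W2 -> k^o).
Hypotheses (p1 : perfect b1) (p2 : perfect b2).
Variables (f : 'Hom(V1, V2)) (f' : 'Hom(W2, W1)).
Hypothesis ff' : forall x y, b2 (f x) y = b1 x (f' y).

Lemma adjoint_surj_inj : (forall y, exists x, f x = y) ->
  forall y, f' y = 0 -> y = 0.
Proof.
move=> fs y y0; have [_ _ _ n2] := p2; apply: n2 => z.
have [x <-] := fs z; by rewrite ff' y0 (perfect0r _ p1).
Qed.

Lemma adjoint_exact (V3 W3 : vectType k) (b3 : V3 -> W3 -> k^o) (g : 'Hom(V2,
  V3))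
    (g' : 'Hom(W3, W2)) : perfect b3 ->
    (forall x y, b3 (g x) y = b2 x (g' y)) ->
    (forall y, g y = 0 <-> exists x, f x = y) ->
  forall y, f' y = 0 <-> exists x, g' x = y.
Proof.
move=> p3 gg' fg y; split=> [y0|[z <-]].
  have [yg|/separating_functional[phi [phi0 phi1]]] := boolP (y \in limg g').
    by case/memv_imgP: yg => z _ ->; exists z.
  have [x xE] := perfect_represents phi p2.
  have /fg[w wE] : g x = 0.
    have [_ _ n3 _] := p3; apply: n3 => z.
    by rewrite gg' xE phi0 // memv_img ?memvf.
  move: phi1; rewrite -xE -wE ff' y0 (perfect0r _ p1) => /esym/eqP.
  by rewrite oner_eq0.
have [_ _ _ n1] := p1; apply: n1 => x; rewrite -ff' -gg'.
suff -> : g (f x) = 0 by apply: perfect0l.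
by apply/fg; exists x.
Qed.

Lemma adjoint_inj_surj : (forall x, f x = 0 -> x = 0) ->
  forall y, exists x, f' x = y.
Proof.
move=> fi y; have [yf|/separating_functional[phi [phi0 phi1]]] := boolP (y \in
  limg f').
  by case/memv_imgP: yf => z _ ->; exists z.
have [x xE] := perfect_represents phi p1.
have x0 : x = 0.
  apply: fi; have [_ _ n2 _] := p2; apply: n2 => z.
  by rewrite ff' xE phi0 // memv_img ?memvf.
move: phi1; rewrite -xE x0 (perfect0l _ p1) => /esym/eqP.
by rewrite oner_eq0.
Qed.

End Adjoints.
End PerfectPairings.

(** * Dual pairs of modules *)

Section Opposite.
Variables (k : fieldType) (C : homFinCat k).

Definition opcat : homFinCat k :=
  @HomFinCat k C (fun a b => hom C b a) (fun a => idm C a)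
    (fun a b c (g : hom C c b) (f : hom C b a) => comp f g)
    (fun a b c (f : hom C b a) => comp_linear_r f)
    (fun a b c (g : hom C c b) => comp_linear_l g)
    (fun a b c d h g f => esym (compA f g h))
    (fun a b f => compm1 f) (fun a b f => comp1m f).

(** A natural perfect pairing makes each of [X] and [M] the dual of the other.
    Working with pairs keeps the two directions of the duality symmetric and
    avoids the isomorphisms between a module and its bidual. *)
Record dual_pair (X : lfdMod opcat) (M : lfdMod C) := DualPair {
  pairing : forall a, M a -> X a -> k^o;
  pairing_perfect : forall a, perfect (@pairing a);
  pairing_natural : forall a b (f : hom C a b) (m : M a) (y : X b),
    pairing (modMap M f m) y = pairing m (modMap X (f : hom opcat b a) y) }.

Implicit Types (X Y : lfdMod opcat) (M N : lfdMod C).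

Definition adjoint X Y M N (bM : dual_pair X M) (bN : dual_pair Y N)
    (u : modHom M N) (v : modHom Y X) : Prop :=
  forall a m y, pairing bN (u a m) y = pairing bM m (v a y).

Lemma dual_left_eq X M (b : dual_pair X M) a (m n : M a) :
  (forall y, pairing b m y = pairing b n y) -> m = n.
Proof.
have [bl _ b0 _] := pairing_perfect b a.
move=> mn; apply: subr0_eq; apply: b0 => y.
by rewrite addrC -scaleN1r bl mn scaleN1r addNr.
Qed.

Lemma dual_right_eq X M (b : dual_pair X M) a (x y : X a) :
  (forall m, pairing b m x = pairing b m y) -> x = y.
Proof.
have [_ br _ b0] := pairing_perfect b a.
move=> xy; apply: subr0_eq; apply: b0 => m.
by rewrite addrC -scaleN1r br xy scaleN1r addNr.
Qed.

Section Adjoint.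
Variables (X Y : lfdMod opcat) (M N : lfdMod C).
Variables (bM : dual_pair X M) (bN : dual_pair Y N).

Lemma left_adjoint (v : modHom Y X) : exists u, adjoint bM bN u v.
Proof.
pose ex a := adjoint_exists (v a) (pairing_perfect bM a) (pairing_perfect bN a).
pose u a := projT1 (cid (ex a)).
have uE a x y : pairing bN (u a x) y = pairing bM x (v a y).
  by rewrite /u; case: cid.
have un a b (f : hom C a b) : (u b \o modMap M f = modMap N f \o u a)%VF.
  apply/lfunP => x; rewrite !comp_lfunE; apply: (dual_left_eq (b := bN)) => y.
  by rewrite uE !pairing_natural uE naturalE.
by exists (ModHom un).
Qed.

Lemma right_adjoint (u : modHom M N) : exists v, adjoint bM bN u v.
Proof.
pose ex a := adjoint_exists (u a) (perfect_flip (pairing_perfect bN a))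
  (perfect_flip (pairing_perfect bM a)).
pose v a := projT1 (cid (ex a)).
have vE a x y : pairing bN (u a x) y = pairing bM x (v a y).
  by rewrite /v; case: cid.
have vn a b (f : hom opcat a b) : (v b \o modMap Y f = modMap X f \o v a)%VF.
  apply/lfunP => y; rewrite !comp_lfunE; apply: (dual_right_eq (b := bM)) => m.
  by rewrite -vE -!pairing_natural -vE naturalE.
by exists (ModHom vn).
Qed.

Lemma adjoint_eq_right u u2 v v2 : adjoint bM bN u v -> adjoint bM bN u2 v2 ->
  (forall a x, u a x = u2 a x) -> forall a y, v a y = v2 a y.
Proof.
move=> uv uv2 E a x; apply: (dual_right_eq (b := bM)) => m.
by rewrite -(uv a) -(uv2 a) E.
Qed.

Lemma adjoint_eq_left u u2 v v2 : adjoint bM bN u v -> adjoint bM bN u2 v2 ->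
  (forall a y, v a y = v2 a y) -> forall a x, u a x = u2 a x.
Proof.
move=> uv uv2 E a x; apply: (dual_left_eq (b := bN)) => y.
by rewrite (uv a) (uv2 a) E.
Qed.

Section Pointwise.
Variables (u : modHom M N) (v : modHom Y X).
Hypothesis uv : adjoint bM bN u v.
Let pM a := pairing_perfect bM a.
Let pN a := pairing_perfect bN a.

Lemma adjoint_pointwise_inj : pointwise_inj u <-> pointwise_surj v.
Proof.
split=> H a.
  by apply: (adjoint_inj_surj (pM a) (pN a)) => [x y|]; [apply: uv|apply: H].
apply: (adjoint_surj_inj (perfect_flip (pN a)) (perfect_flip (pM a))) => [x y|];
  [exact/esym/uv|exact: H].
Qed.

Lemma adjoint_pointwise_surj : pointwise_surj u <-> pointwise_inj v.
Proof.
split=> H a.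
  by apply: (adjoint_surj_inj (pM a) (pN a)) => [x y|]; [apply: uv|apply: H].
apply: (adjoint_inj_surj (perfect_flip (pN a)) (perfect_flip (pM a))) => [x y|];
  [exact/esym/uv|exact: H].
Qed.

End Pointwise.
End Adjoint.

Lemma adjoint_comp X Y Z (M N P : lfdMod C) (bM : dual_pair X M)
    (bN : dual_pair Y N) (bP : dual_pair Z P) u v u2 v2 :
  adjoint bM bN u v -> adjoint bN bP u2 v2 ->
  adjoint bM bP (compmod u2 u) (compmod v v2).
Proof. by move=> uv uv2 a m y; rewrite !compmodE uv2 uv. Qed.

Lemma adjoint_id X M (b : dual_pair X M) : adjoint b b (idmod M) (idmod X).
Proof. by move=> a m y; rewrite !idmodE. Qed.

Lemma adjoint_zero X M (b : dual_pair X M) :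
  adjoint b b (zerohom M M) (zerohom X X).
Proof.
move=> a m y; rewrite !zerohomE; have pb := pairing_perfect b a.
by rewrite (perfect0l _ pb) (perfect0r _ pb).
Qed.

Lemma adjoint_exact_pair X Y Z (L M N : lfdMod C) (bL : dual_pair X L)
    (bM : dual_pair Y M) (bN : dual_pair Z N) f f' g g' :
  adjoint bL bM f f' -> adjoint bM bN g g' ->
  exact_pair f g <-> exact_pair g' f'.
Proof.
move=> ff gg; pose pL a := pairing_perfect bL a;
  pose pM a := pairing_perfect bM a.
pose pN a := pairing_perfect bN a; split=> H a.
  by apply: (adjoint_exact (pL a) (pM a) _ (pN a) _ (H a)) => x y;
    [apply: ff|apply: gg].
by apply: (adjoint_exact (perfect_flip (pN a)) (perfect_flip (pM a)) _
  (perfect_flip (pL a)) _ (H a)) => x y; [apply/esym/gg|apply/esym/ff].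
Qed.

Lemma adjoint_ses X Y Z (L M N : lfdMod C) (bL : dual_pair X L)
    (bM : dual_pair Y M) (bN : dual_pair Z N) f f' g g' :
  adjoint bL bM f f' -> adjoint bM bN g g' -> ses f g <-> ses g' f'.
Proof.
move=> ff gg; split=> -[i e s]; split.
- exact/(adjoint_pointwise_surj gg).
- exact/(adjoint_exact_pair ff gg).
- exact/(adjoint_pointwise_inj ff).
- exact/(adjoint_pointwise_inj ff).
- exact/(adjoint_exact_pair ff gg).
- exact/(adjoint_pointwise_surj gg).
Qed.

Lemma adjoint_section X Y M N (bM : dual_pair X M) (bN : dual_pair Y N) u v :
  adjoint bM bN u v -> ex_section u <-> ex_retraction v.
Proof.
move=> uv; split=> [[r ru]|[r vr]].
  have [s rs] := right_adjoint bN bM r; exists s => a y.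
  rewrite -compmodE -[RHS]idmodE.
  apply: (adjoint_eq_right (adjoint_comp uv rs) (adjoint_id bM)) => b x.
  by rewrite compmodE idmodE.
have [s rs] := left_adjoint bN bM r; exists s => a y.
rewrite -compmodE -[RHS]idmodE.
apply: (adjoint_eq_left (adjoint_comp uv rs) (adjoint_id bM)) => b x.
by rewrite compmodE idmodE.
Qed.

Lemma adjoint_retraction X Y M N (bM : dual_pair X M) (bN : dual_pair Y N) u v :
  adjoint bM bN u v -> ex_retraction u <-> ex_section v.
Proof.
move=> uv; split=> [[r ru]|[r vr]].
  have [s rs] := right_adjoint bN bM r; exists s => a y.
  rewrite -compmodE -[RHS]idmodE.
  apply: (adjoint_eq_right (adjoint_comp rs uv) (adjoint_id bN)) => b x.
  by rewrite compmodE idmodE.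
have [s rs] := left_adjoint bN bM r; exists s => a y.
rewrite -compmodE -[RHS]idmodE.
apply: (adjoint_eq_left (adjoint_comp rs uv) (adjoint_id bN)) => b x.
by rewrite compmodE idmodE.
Qed.

Lemma dual_zero X M (b : dual_pair X M) : is_zero_mod M <-> is_zero_mod X.
Proof.
split=> z a x.
  apply: (dual_right_eq (b := b)) => m; rewrite (z a m).
  by rewrite !(perfect0l _ (pairing_perfect b a)).
apply: (dual_left_eq (b := b)) => y; rewrite (z a y).
by rewrite !(perfect0r _ (pairing_perfect b a)).
Qed.

Lemma dual_indecomposable X M (b : dual_pair X M) :
  indecomposable M <-> indecomposable X.
Proof.
split=> /indecomposable_idempotent[M0 idM]; apply/indecomposable_idempotent.
  split=> [/(dual_zero b)//|e ee]; have [u ue] := left_adjoint b b e.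
  have [|u0|u1] := idM u.
  - move=> a x; rewrite -compmodE.
    apply: (adjoint_eq_left (adjoint_comp ue ue) ue) => c y.
    by rewrite compmodE ee.
  - left=> a x; rewrite -(zerohomE X x);
      apply: (adjoint_eq_right ue (adjoint_zero b)).
    by move=> c y; rewrite zerohomE.
  - right=> a x; rewrite -[RHS]idmodE;
      apply: (adjoint_eq_right ue (adjoint_id b)).
    by move=> c y; rewrite idmodE.
split=> [/(dual_zero b)//|u uu]; have [e ue] := right_adjoint b b u.
have [|e0|e1] := idM e.
- move=> a x; rewrite -compmodE.
  apply: (adjoint_eq_right (adjoint_comp ue ue) ue) => c y.
  by rewrite compmodE uu.
- left=> a x; rewrite -(zerohomE M x);
    apply: (adjoint_eq_left ue (adjoint_zero b)).
  by move=> c y; rewrite zerohomE.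
- right=> a x; rewrite -[RHS]idmodE; apply: (adjoint_eq_left ue (adjoint_id b)).
  by move=> c y; rewrite idmodE.
Qed.

End Opposite.
(** * Transport along the duality *)

Section DualModules.
Variables (k : fieldType) (C : homFinCat k).
Local Notation C' := (opcat C).

Lemma evaluation_perfect (V : vectType k) :
  perfect (fun (v : V) (phi : 'Hom(V, k^o)) => phi v).
Proof.
split=> [phi|v|v|phi phi0]; first exact: linearP.
- by move=> t phi psi; rewrite add_lfunE scale_lfunE.
- exact: functionals_separate.
- by apply/lfunP => v; rewrite phi0 zero_lfunE.
Qed.

Section Dual.
Variable M : lfdMod C.

Definition dual_map a b (f : hom C' a b) (phi : 'Hom(M a, k^o)) :
  'Hom(M b, k^o) := (phi \o modMap M (f : hom C b a))%VF.

Fact dual_map_linear a b (f : hom C' a b) : linear (dual_map f).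
Proof. by move=> t x y; rewrite /dual_map comp_lfunDl comp_lfunZl. Qed.

Fact dual_map_linear_r a b (phi : 'Hom(M a, k^o)) :
  linear (fun f : hom C' a b => dual_map f phi).
Proof.
move=> t f g; apply/lfunP => x.
by rewrite add_lfunE scale_lfunE !comp_lfunE modMap_lin linearP.
Qed.

Fact dual_map1 a (phi : 'Hom(M a, k^o)) : dual_map (idm C' a) phi = phi.
Proof. by apply/lfunP => x; rewrite comp_lfunE modMap_id. Qed.

Fact dual_mapM a b c (g : hom C' b c) (f : hom C' a b) (phi : 'Hom(M a, k^o)) :
  dual_map (comp g f) phi = dual_map g (dual_map f phi).
Proof. by apply/lfunP => x; rewrite !comp_lfunE modMap_comp. Qed.

Definition dual_mod : lfdMod C' :=
  mkmod dual_map_linear dual_map_linear_r dual_map1 dual_mapM.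

Fact dual_mod_natural a b (f : hom C a b) (m : M a) (phi : dual_mod b) :
  (phi : 'Hom(M b, k^o)) (modMap M f m)
  = (modMap dual_mod (f : hom C' b a) phi : 'Hom(M a, k^o)) m.
Proof. by rewrite mkmodE comp_lfunE. Qed.

Definition dual_mod_pair : dual_pair dual_mod M :=
  @DualPair k C dual_mod M
    (fun a m (phi : dual_mod a) => (phi : 'Hom(M a, k^o)) m)
    (fun a => evaluation_perfect (M a)) dual_mod_natural.

End Dual.

Section Predual.
Variable X : lfdMod C'.

Definition predual_map a b (f : hom C a b) (phi : 'Hom(X a, k^o)) :
  'Hom(X b, k^o) := (phi \o modMap X (f : hom C' b a))%VF.

Fact predual_map_linear a b (f : hom C a b) : linear (predual_map f).
Proof. by move=> t x y; rewrite /predual_map comp_lfunDl comp_lfunZl. Qed.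

Fact predual_map_linear_r a b (phi : 'Hom(X a, k^o)) :
  linear (fun f : hom C a b => predual_map f phi).
Proof.
move=> t f g; apply/lfunP => x.
rewrite add_lfunE scale_lfunE !comp_lfunE -linearP; congr (phi _).
exact: (@modMap_lin _ C').
Qed.

Fact predual_map1 a (phi : 'Hom(X a, k^o)) : predual_map (idm C a) phi = phi.
Proof. by apply/lfunP => x; rewrite comp_lfunE (@modMap_id _ C'). Qed.

Fact predual_mapM a b c (g : hom C b c) (f : hom C a b) (phi : 'Hom(X a, k^o)) :
  predual_map (comp g f) phi = predual_map g (predual_map f phi).
Proof.
apply/lfunP => x; rewrite !comp_lfunE; congr (phi _).
exact: (@modMap_comp _ C' X c b a f g).
Qed.

Definition predual_mod : lfdMod C :=
  mkmod predual_map_linear predual_map_linear_r predual_map1 predual_mapM.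

Fact predual_mod_natural a b (f : hom C a b) (phi : predual_mod a) (x : X b) :
  (modMap predual_mod f phi : 'Hom(X b, k^o)) x
  = (phi : 'Hom(X a, k^o)) (modMap X (f : hom C' b a) x).
Proof. by rewrite mkmodE comp_lfunE. Qed.

Definition predual_mod_pair : dual_pair X predual_mod :=
  @DualPair k C X predual_mod
    (fun a (phi : predual_mod a) x => (phi : 'Hom(X a, k^o)) x)
    (fun a => perfect_flip (evaluation_perfect (X a))) predual_mod_natural.

End Predual.

Section DualSum.
Variables (X Y : lfdMod C') (M N : lfdMod C).
Variables (bM : dual_pair X M) (bN : dual_pair Y N).

Definition dsum_pairing a (m : dsum M N a) (x : dsum X Y a) : k^o :=
  pairing bM m.1 x.1 + pairing bN m.2 x.2.

Fact dsum_perfect a : perfect (@dsum_pairing a).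
Proof.
have pM := pairing_perfect bM a; have pN := pairing_perfect bN a.
rewrite /dsum_pairing; case: (pM) => lM rM M0 X0; case: (pN) => lN rN N0 Y0.
split=> [x|m|m m0|x x0].
- move=> t m m'; rewrite lM lN scalerDr -!addrA; congr (_ + _).
  by rewrite addrCA.
- move=> t x x'; rewrite rM rN scalerDr -!addrA; congr (_ + _).
  by rewrite addrCA.
- case: m m0 => m n m0; congr pair.
    by apply: M0 => x; have := m0 (x, 0); rewrite /= (perfect0r _ pN) addr0.
  by apply: N0 => y; have := m0 (0, y); rewrite /= (perfect0r _ pM) add0r.
- case: x x0 => x y x0; congr pair.
    by apply: X0 => m; have := x0 (m, 0); rewrite /= (perfect0l _ pN) addr0.
  by apply: Y0 => n; have := x0 (0, n); rewrite /= (perfect0l _ pM) add0r.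
Qed.

Fact dsum_pairing_natural a b (f : hom C a b) m x :
  dsum_pairing (modMap (dsum M N) f m) x
  = dsum_pairing m (modMap (dsum X Y) (f : hom C' b a) x).
Proof. by rewrite /dsum_pairing !dsumE /= !pairing_natural. Qed.

Definition dsum_pair : dual_pair (dsum X Y) (dsum M N) :=
  DualPair dsum_perfect dsum_pairing_natural.

End DualSum.

Fact zero_perfect a :
  perfect (fun (m : zero_mod C a) (x : zero_mod C' a) => 0 : k^o).
Proof.
split=> [x|m|m _|x _]; try by move=> t y z; rewrite scaler0 addr0.
  by apply/rowP => -[].
by apply/rowP => -[].
Qed.

Definition zero_pair : dual_pair (zero_mod C') (zero_mod C) :=
  @DualPair k C (zero_mod C') (zero_mod C) (fun _ _ _ => 0)
    zero_perfect (fun a b f m x => erefl).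

Fact representable_natural a b c (f : hom C b c) (phi : inj_mod (A := C) a b)
    (x : proj_mod (A := C') a c) :
  (modMap (inj_mod (A := C) a) f phi : 'Hom(hom C c a, k^o)) x
  = (phi : 'Hom(hom C b a, k^o))
      (modMap (proj_mod (A := C') a) (f : hom C' c b) x).
Proof. by do !rewrite lfunE /=. Qed.

Definition representable_pair a :
    dual_pair (proj_mod (A := C') a) (inj_mod (A := C) a) :=
  @DualPair k C (proj_mod (A := C') a) (inj_mod (A := C) a)
    (fun b (phi : 'Hom(hom C b a, k^o)) x => phi x)
    (fun b => perfect_flip (evaluation_perfect (hom C b a)))
    (@representable_natural a).

Fixpoint sum_pair (s : seq C) :
    dual_pair (proj_sum (A := C') s) (inj_sum (A := C) s) :=
  if s is a :: s' then dsum_pair (representable_pair a) (sum_pair s')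
  else zero_pair.

Lemma dual_projective_injective (X : lfdMod C') (M : lfdMod C) (b : dual_pair X
  M) :
  projective_mod X -> injective_mod M.
Proof.
move=> pX U V i u /monomorphismP ii.
have [i' adji] := right_adjoint (dual_mod_pair U) (dual_mod_pair V) i.
have [u' adju] := right_adjoint (dual_mod_pair U) b u.
have i's : pointwise_surj i' by apply/(adjoint_pointwise_inj adji).
have [v' vE] := pX _ _ i' u' ((epimorphismP i').2 i's).
have [v adjv] := left_adjoint (dual_mod_pair V) b v'.
exists v; apply: eqmodI; apply: (adjoint_eq_left (adjoint_comp adji adjv) adju).
exact: eqmodE.
Qed.

Lemma fin_presentedE (D : homFinCat k) (X : lfdMod D) : fin_presented X <->
  exists s (p : modHom (proj_sum s) X) K (i : modHom K (proj_sum s)),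
    ses i p /\ exists t (q : modHom (proj_sum t) K), pointwise_surj q.
Proof.
by split=> -[s [p [K [i [/short_exactP ip /fin_generatedP q]]]]];
  exists s, p, K, i.
Qed.

Lemma fin_copresentedE (M : lfdMod C) : fin_copresented M <->
  exists s (i : modHom M (inj_sum s)) Q (p : modHom (inj_sum s) Q),
    ses i p /\ exists t (j : modHom Q (inj_sum t)), pointwise_inj j.
Proof.
split=> -[s [i [Q [p [/short_exactP ip [t [j /monomorphismP jm]]]]]]].
  by exists s, i, Q, p; split=> //; exists t, j.
by exists s, i, Q, p; split=> //; exists t, j.
Qed.

Lemma dual_fin_presented (X : lfdMod C') (M : lfdMod C) (b : dual_pair X M) :
  fin_copresented M <-> fin_presented X.
Proof.
split=> [/fin_copresentedE|/fin_presentedE].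
  move=> [s [i [Q [p [ip [t [j ji]]]]]]].
  have [i' adji] := right_adjoint b (sum_pair s) i.
  have [p' adjp] := right_adjoint (sum_pair s) (dual_mod_pair Q) p.
  have [j' adjj] := right_adjoint (dual_mod_pair Q) (sum_pair t) j.
  apply/fin_presentedE; exists s, i', (dual_mod Q), p'; split.
    exact/(adjoint_ses adji adjp).
  by exists t, j'; apply/(adjoint_pointwise_inj adjj).
move=> [s [p [K [i [ip [t [q qs]]]]]]].
have [p' adjp] := left_adjoint b (sum_pair s) p.
have [i' adji] := left_adjoint (sum_pair s) (predual_mod_pair K) i.
have [q' adjq] := left_adjoint (predual_mod_pair K) (sum_pair t) q.
apply/fin_copresentedE; exists s, p', (predual_mod K), i'; split.
  exact/(adjoint_ses adjp adji).
by exists t, q'; apply/(adjoint_pointwise_inj adjq).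
Qed.

End DualModules.

Section DualSequences.
Variables (k : fieldType).

Variable C : homFinCat k.
Local Notation C' := (opcat C).
Variables (X Y Z : lfdMod C') (L M N : lfdMod C).
Variables (bL : dual_pair X L) (bM : dual_pair Y M) (bN : dual_pair Z N).
Variables (f : modHom L M) (g : modHom M N) (f' : modHom Y X) (g' : modHom Z Y).
Hypotheses (adjf : adjoint bL bM f f') (adjg : adjoint bM bN g g').

Lemma dual_almost_split : almost_split f g <-> almost_split g' f'.
Proof.
split=> /almost_splitE[fg gn iL iN [fl gl]]; apply/almost_splitE.
  have g'f' : ses g' f' by apply/(adjoint_ses adjf adjg).
  split=> //; [|exact/(dual_indecomposable bN)|exact/(dual_indecomposable bL)|].
    case: g'f' => g'i g'f' _ /(short_exact_splits g'i g'f').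
    by move/(adjoint_retraction adjg).
  split=> W u un.
    have [v adjv] := left_adjoint (predual_mod_pair W) bN u.
    have [|w wE] := gl _ v; first by move/(adjoint_retraction adjv).
    have [w' adjw] := right_adjoint (predual_mod_pair W) bM w; exists w' => a x.
    rewrite -compmodE.
    exact: (adjoint_eq_right (adjoint_comp adjw adjg) adjv
      (fun b y => etrans (compmodE _ _ _) (wE b y))).
  have [v adjv] := left_adjoint bL (predual_mod_pair W) u.
  have [|w wE] := fl _ v; first by move/(adjoint_section adjv).
  have [w' adjw] := right_adjoint bM (predual_mod_pair W) w; exists w' => a x.
  rewrite -compmodE.
  exact: (adjoint_eq_right (adjoint_comp adjf adjw) adjv
    (fun b y => etrans (compmodE _ _ _) (wE b y))).
have f_g : ses f g by apply/(adjoint_ses adjf adjg).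
split=> //; [|exact/(dual_indecomposable bL)|exact/(dual_indecomposable bN)|].
  case: f_g => fi f_g _ /(short_exact_splits fi f_g).
  by move/(adjoint_section adjf).
split=> W u un.
  have [v adjv] := right_adjoint bL (dual_mod_pair W) u.
  have [|w wE] := gl _ v; first by move/(adjoint_section adjv).
  have [w' adjw] := left_adjoint bM (dual_mod_pair W) w; exists w' => a x.
  rewrite -compmodE.
  exact: (adjoint_eq_left (adjoint_comp adjf adjw) adjv
    (fun b y => etrans (compmodE _ _ _) (wE b y))).
have [v adjv] := right_adjoint (dual_mod_pair W) bN u.
have [|w wE] := fl _ v; first by move/(adjoint_retraction adjv).
have [w' adjw] := left_adjoint (dual_mod_pair W) bM w; exists w' => a x.
rewrite -compmodE.
exact: (adjoint_eq_left (adjoint_comp adjw adjg) adjv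
  (fun b y => etrans (compmodE _ _ _) (wE b y))).
Qed.

End DualSequences.

Lemma dual_almost_split_starting (k : fieldType) (C : homFinCat k)
    (X : lfdMod (opcat C)) (M : lfdMod C) (b : dual_pair X M) :
  almost_split_starting M <-> almost_split_ending X.
Proof.
split=> [[E [N [f [g fg]]]]|[L [E [f [g fg]]]]].
  have [f' adjf] := right_adjoint b (dual_mod_pair E) f.
  have [g' adjg] := right_adjoint (dual_mod_pair E) (dual_mod_pair N) g.
  exists (dual_mod N), (dual_mod E), g', f'.
  exact/(dual_almost_split adjf adjg).
have [g' adjg] := left_adjoint b (predual_mod_pair E) g.
have [f' adjf] := left_adjoint (predual_mod_pair E) (predual_mod_pair L) f.
exists (predual_mod E), (predual_mod L), g', f'.
exact/(dual_almost_split adjg adjf).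
Qed.

Theorem corollary4p2 (k : closedFieldType) (A : spectroid k) (M : lfdMod A)
    (indecM : indecomposable M) :
  (~ projective_mod M -> (almost_split_ending M <-> fin_presented M)) /\
  (~ injective_mod M -> (almost_split_starting M <-> fin_copresented M)).
Proof.
split=> [npM|niM]; first exact: almost_split_ending_fin_presented.
pose b := dual_mod_pair M.
have indX : indecomposable (dual_mod M) by apply/(dual_indecomposable b).
have npX : ~ projective_mod (dual_mod M) by move/(dual_projective_injective b).
rewrite (dual_almost_split_starting b) (dual_fin_presented b).
exact: almost_split_ending_fin_presented.
Qed.
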